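(* Suppose that $S\subset\mathbb{P}^3$ is a skew generic scroll. Then $S$ is a rational normal scroll; that is, $S$ is over $\mathbb{P}^1$ with bidegree $(1,1)$.
   Context: Everything is over $\mathbb{C}$. Let $C$ be a smooth (irreducible, projective) curve of genus $g$ and let $\iota_1,\iota_2:C\hookrightarrow\mathbb{P}^N$ be two embeddings of degrees $d_1,d_2$. The scroll with respect to $(\iota_1,\iota_2)$ is $$S:=\bigcup_{t\in C}\langle\iota_1(t),\iota_2(t)\rangle,$$ where $\langle\cdot,\cdot\rangle$ denotes the linear span; $S$ is called a scroll of bidegree $(d_1,d_2)$ over $C$. (It is not assumed that $\iota_1(C)$ and $\iota_2(C)$ lie in disjoint linear subspaces.) The scroll is skew if $\langle\iota_1(t),\iota_2(t)\rangle\cap\langle\iota_1(s),\iota_2(s)\rangle=\emptyset$ for any two distinct $t,s\in C$. The scroll is generic if $\iota_1,\iota_2$ are generic under $\mathrm{PGL}(N+1)$ actions, i.e. $(\iota_1,\iota_2)$ is a general member of its orbit $\{(g_1\circ\iota_1,g_2\circ\iota_2)\}$ under $(g_1,g_2)\in\mathrm{PGL}(N+1)\times\mathrm{PGL}(N+1)$ (with $(g_1,g_2)$ in a suitable dense open subset); in particular, for $N\ge3$, the embedded tangent lines $T_{\iota_1(t),\iota_1(C)}$ and $T_{\iota_2(t),\iota_2(C)}$ are disjoint for generic $t\in C$. *)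

(* Defs.v *)
From HB Require Import structures.
From mathcomp Require Import all_boot all_order all_algebra.
From mathcomp Require Import mpoly.

Set Implicit Arguments.
Unset Strict Implicit.
Unset Printing Implicit Defensive.

Import GRing.Theory.
Local Open Scope ring_scope.

(* Classical (reduced) varieties over an algebraically closed field K.  A     *)
(* point of P^n is given by homogeneous coordinates, a nonzero row vector of  *)
(* size n + 1, and two vectors are the same point when they have the same row *)
(* space: (x == y)%MS.                                                        *)

Section ProjectiveSets.
Variable K : fieldType.

Definition pset (n : nat) := 'rV[K]_n.+1 -> Prop.

Definition pspace (n : nat) : pset n := fun x => x != 0.

Definition psubset n (X Y : pset n) := forall x, X x -> Y x.

Definition pclosed n (X : pset n) : Prop :=
  exists S : {mpoly K[n.+1]} -> Prop,
    (forall F, S F -> exists d, F \is d.-homog) /\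
    (forall x, X x <-> x != 0 /\ forall F, S F -> F.@[x 0] = 0).

Definition popen n (U : pset n) : Prop :=
  psubset U (@pspace n) /\ pclosed (fun x => x != 0 /\ ~ U x).

Definition pdense n (U : pset n) : Prop :=
  forall V : pset n, popen V -> (exists x, V x) -> exists x, U x /\ V x.

Definition irreducible n (X : pset n) : Prop :=
  (exists x, X x) /\
  forall A B : pset n, pclosed A -> pclosed B ->
    (forall x, X x -> A x \/ B x) -> psubset X A \/ psubset X B.

Definition closed_chain n (X : pset n) (d : nat) : Prop :=
  exists Z : nat -> pset n,
    (forall i, (i <= d)%N ->
       [/\ pclosed (Z i), irreducible (Z i) & psubset (Z i) X]) /\
    (forall i, (i < d)%N ->
       psubset (Z i) (Z i.+1) /\ ~ psubset (Z i.+1) (Z i)).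

Definition has_dim n (X : pset n) (d : nat) : Prop :=
  closed_chain X d /\ ~ closed_chain X d.+1.

(* Vectors of the affine cone over the embedded projective tangent space      *)
(* of X at x; F ranges over the homogeneous ideal of X.                       *)
Definition tangent n (X : pset n) (x v : 'rV[K]_n.+1) : Prop :=
  forall (F : {mpoly K[n.+1]}) (d : nat), F \is d.-homog ->
    (forall y, X y -> F.@[y 0] = 0) ->
    \sum_(i < n.+1) (F^`M(i)).@[x 0] * v 0 i = 0.

Definition smooth n (X : pset n) (d : nat) : Prop :=
  forall x, X x ->
    exists T : 'M[K]_(d.+1, n.+1),
      row_free T /\ forall v : 'rV[K]_n.+1, (v <= T)%MS <-> tangent X x v.

Definition smooth_curve n (C : pset n) : Prop :=
  [/\ pclosed C, irreducible C, has_dim C 1 & smooth C 1].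

Definition poly_map m n (F : 'I_n.+1 -> {mpoly K[m.+1]}) (x : 'rV[K]_m.+1) :
  'rV[K]_n.+1 := \row_i (F i).@[x 0].

(* Near each point the map is given by forms of one degree without common     *)
(* zeros.  Multiplying the forms by a form that is nonzero at x, any          *)
(* neighbourhood of x in X can be taken to be the locus where they do not all *)
(* vanish.  Values of f outside X are irrelevant.                             *)
Definition regular m n (X : pset m) (f : 'rV[K]_m.+1 -> 'rV[K]_n.+1) : Prop :=
  forall x, X x ->
    exists (d : nat) (F : 'I_n.+1 -> {mpoly K[m.+1]}),
      [/\ forall i, F i \is d.-homog,
          poly_map F x != 0 &
          forall y, X y -> poly_map F y != 0 -> (f y == poly_map F y)%MS].

Definition morphism m n (X : pset m) (Y : pset n)
    (f : 'rV[K]_m.+1 -> 'rV[K]_n.+1) : Prop :=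
  regular X f /\ forall x, X x -> Y (f x).

Definition isomorphism m n (X : pset m) (Y : pset n)
    (f : 'rV[K]_m.+1 -> 'rV[K]_n.+1) : Prop :=
  morphism X Y f /\
  exists g : 'rV[K]_n.+1 -> 'rV[K]_m.+1,
    [/\ morphism Y X g,
        forall x, X x -> (g (f x) == x)%MS &
        forall y, Y y -> (f (g y) == y)%MS].

Definition isomorphic m n (X : pset m) (Y : pset n) : Prop :=
  exists f, isomorphism X Y f.

Definition pimage m n (X : pset m) (f : 'rV[K]_m.+1 -> 'rV[K]_n.+1) : pset n :=
  fun y => y != 0 /\ exists x, X x /\ (y == f x)%MS.

Definition embedding m n (X : pset m) (f : 'rV[K]_m.+1 -> 'rV[K]_n.+1) : Prop :=
  pclosed (pimage X f) /\ isomorphism X (pimage X f) f.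

Definition card_points n (X : pset n) (d : nat) : Prop :=
  exists p : 'I_d -> 'rV[K]_n.+1,
    [/\ forall i, X (p i),
        forall i j, (p i == p j)%MS -> i = j &
        forall x, X x -> exists i, (x == p i)%MS].

(* The degree of a projective curve X: the number of points of X on a general *)
(* hyperplane, h being the hyperplane's coordinates in the dual space.        *)
Definition curve_degree n (X : pset n) (d : nat) : Prop :=
  exists U : pset n,
    [/\ popen U, pdense U &
        forall h, U h -> card_points (fun x => X x /\ x *m h^T = 0) d].

(* PGL(m) x PGL(m) is represented by pairs of invertible matrices up to       *)
(* separate scaling.  It carries the quotient of the Zariski topology of      *)
(* GL(m) x GL(m), so its open subsets are the scaling-invariant open subsets  *)
(* of GL(m) x GL(m).                                                          *)
Definition pgl2_open m (U : 'M[K]_m -> 'M[K]_m -> Prop) : Prop :=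
  [/\ forall g h, U g h -> g \in unitmx /\ h \in unitmx,
      forall (a b : K) g h, a != 0 -> b != 0 -> U g h -> U (a *: g) (b *: h) &
      exists S : {mpoly K[m * m + m * m]} -> Prop,
        forall g h, g \in unitmx -> h \in unitmx ->
          (U g h <->
           exists F, S F /\ F.@[row_mx (mxvec g) (mxvec h) 0] != 0)].

Definition pgl2_dense m (U : 'M[K]_m -> 'M[K]_m -> Prop) : Prop :=
  forall V : 'M[K]_m -> 'M[K]_m -> Prop, pgl2_open V ->
    (exists g h, V g h) -> exists g h, U g h /\ V g h.

Definition generically m (P : 'M[K]_m -> 'M[K]_m -> Prop) : Prop :=
  exists U : 'M[K]_m -> 'M[K]_m -> Prop,
    [/\ pgl2_open U, pgl2_dense U & forall g1 g2, U g1 g2 -> P g1 g2].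

Definition translate m n (g : 'M[K]_n.+1) (f : 'rV[K]_m.+1 -> 'rV[K]_n.+1) :
  'rV[K]_m.+1 -> 'rV[K]_n.+1 := fun x => f x *m g.

Definition scroll n N (C : pset n) (f1 f2 : 'rV[K]_n.+1 -> 'rV[K]_N.+1)
    (d1 d2 : nat) (S : pset N) : Prop :=
  [/\ smooth_curve C,
      embedding C f1 /\ curve_degree (pimage C f1) d1,
      embedding C f2 /\ curve_degree (pimage C f2) d2 &
      forall y, S y <-> y != 0 /\ exists t, C t /\ (y <= f1 t + f2 t)%MS].

Definition skew_scroll n N (C : pset n) (f1 f2 : 'rV[K]_n.+1 -> 'rV[K]_N.+1) : Prop :=
  forall t s, C t -> C s -> ~~ (t == s)%MS ->
    ((f1 t + f2 t) :&: (f1 s + f2 s))%MS = 0.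

End ProjectiveSets.

Arguments pspace K n : clear implicits.

(* Main.v *)
Require Import Defs.
From mathcomp Require Import all_boot all_order all_fingroup all_algebra.
From mathcomp Require Import reals complex mpoly boolp classical_sets.
From mathcomp Require Import ring zify lra.

Set Implicit Arguments.
Unset Strict Implicit.
Unset Printing Implicit Defensive.

Import Order.TTheory GRing.Theory Num.Theory.
Local Open Scope ring_scope.

(** The idea is to project from a single ruling of the scroll.  Fix a point s of
the curve C and write j1, j2 for the two embeddings after a generic translation.
Projection from the line joining j1(s) to j2(s) gives two maps from C minus s to
the projective line, and skewness says that they never agree.  At s the two maps
extend by the tangent directions of j1 and j2, and these are different if the
tangent lines are disjoint, which is a generic condition.  So the pair of maps is
a morphism from C to the complement of the diagonal in the product of two
projective lines.  This complement is affine, hence the morphism is constant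
(lemma projection_from_ruling).  Thus j1(C) lies in the plane spanned by its
tangent line at s and j2(s); in generic position this is only possible if j1(C) is
contained in its tangent line (skew_scroll_line).  The same holds for j2.  A closed
irreducible curve in a line is the whole line, so C is a projective line and both
degrees are 1.  Only rulings which really are lines can be used in this way: that
j1(t) and j2(t) are distinct for all t is a further generic condition.

The proof rests on three ingredients.  The first is the Nullstellensatz,
over an uncountable algebraically closed field, where it has a short proof by
counting dimensions (proper_ideal_specialize).  It yields that regular functions
on a closed irreducible set are constant: they act on the monomials of some large
degree by a constant matrix, and their values are eigenvalues of that matrix
(regular_function_const).  It also yields that the pairs of matrices for which
j1(t) and j2(t) are distinct for all t contain a nonempty open set, as soon as
there is one such pair, possibly of singular matrices (disjointness_open); that
pair is found with the help of lines that miss the curves.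

The second is a local parameter at a smooth point: a linear form which divides all
forms vanishing at the point, up to a denominator (local_parameter).  It is what
makes the extension of the projections to s explicit.  The third is that embeddings
are immersions (embedding_immersion); without it the condition on the tangent
lines might hold for no translation at all. *)

(** * Polynomials, their values and their differentials *)

Lemma mpoly_algebra_ind (K : comNzRingType) n (P : {mpoly K[n]} -> Prop) :
  (forall c, P c%:MP) -> (forall i, P 'X_i) ->
  (forall F G, P F -> P G -> P (F + G)) ->
  (forall F G, P F -> P G -> P (F * G)) -> forall F, P F.
Proof.
move=> PC PX PD PM F; rewrite (mpolyE F); elim/big_rec: _ => [|m G _ PG].
  by rewrite -(mpolyC0 n); exact: PC.
apply: (PD _ _) => //; rewrite -mul_mpolyC; apply: (PM _ _); first exact: PC.
rewrite mpolyXE_id; elim/big_rec: _ => [|i H _ PH].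
  by rewrite -(mpolyC1 n); exact: PC.
apply: (PM _ _) => //; elim: (m i) => [|k IH].
  by rewrite expr0 -(mpolyC1 n); exact: PC.
by rewrite exprS; apply: (PM _ _).
Qed.

Section PolynomialValues.
Variable K : numClosedFieldType.
Implicit Types (n d : nat).

Lemma exists_nonroot (p : {poly K}) : p != 0 -> exists t, p.[t] != 0.
Proof. by move/closed_nonrootP => [t]; exists t. Qed.

Definition along n (F : {mpoly K[n]}) (p : 'I_n -> {poly K}) : {poly K} :=
  mmap (@polyC K) p F.

Lemma horner_along n (F : {mpoly K[n]}) p t :
  (along F p).[t] = F.@[fun i => (p i).[t]].
Proof.
rewrite /along; elim/mpoly_algebra_ind: F => [c|i|F G hF hG|F G hF hG].
- by rewrite mmapC mevalC hornerC.
- by rewrite mmapX mmap1U mevalXU.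
- by rewrite mmapD hornerD mevalD hF hG.
- by rewrite rmorphM hornerM mevalM hF hG.
Qed.

Lemma deriv_along n (F : {mpoly K[n]}) p :
  (along F p)^`() = \sum_i along F^`M(i) p * (p i)^`().
Proof.
rewrite /along; elim/mpoly_algebra_ind: F => [c|i|F G hF hG|F G hF hG].
- by rewrite mmapC derivC big1 // => i _; rewrite mderivC raddf0 mul0r.
- rewrite mmapX mmap1U (bigD1 i) //= big1 => [|j ji].
    rewrite mderivX mnm1E eqxx scale1r addr0.
    have -> : (U_(i) - U_(i))%MM = 0%MM :> 'X_{1..n}.
      by apply/mnmP => k; rewrite mnmBE subnn mnm0E.
    by rewrite mpolyX0 rmorph1 mul1r.
  by rewrite mderivX mnm1E eq_sym (negbTE ji) scale0r raddf0 mul0r.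
- rewrite mmapD derivD hF hG -big_split /=; apply: eq_bigr => i _.
  by rewrite mderivD mmapD mulrDl.
- rewrite rmorphM derivM hF hG mulr_suml mulr_sumr -big_split /=.
  apply: eq_bigr => i _.
  by rewrite mderivM rmorphD !rmorphM mulrDl mulrAC -!mulrA.
Qed.

(** In characteristic zero a polynomial function that vanishes identically has
identically vanishing derivatives, and a suitable iterated derivative isolates
any given coefficient. *)
Lemma mpoly_fun_eq0 n (F : {mpoly K[n]}) :
  (forall x : 'I_n -> K, F.@[x] = 0) -> F = 0.
Proof.
have step (G : {mpoly K[n]}) i :
    (forall x : 'I_n -> K, G.@[x] = 0) -> forall x : 'I_n -> K, G^`M(i).@[x] = 0.
  move=> G0 x; pose p j : {poly K} := (x j)%:P + (j == i)%:R *: 'X.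
  have ap0 : along G p = 0.
    apply/eqP; apply/negP => /negP/exists_nonroot[t].
    by rewrite horner_along G0 eqxx.
  have := congr1 (fun q => q^`().[0]) ap0.
  rewrite deriv_along derivC horner0 (bigD1 i) //= big1 => [|j ji].
    have -> : (p i)^`() = 1 by rewrite /p eqxx scale1r derivD derivC derivX add0r.
    rewrite addr0 mulr1 horner_along => d0; rewrite -[RHS]d0; apply: meval_eq => j.
    by rewrite /p hornerD hornerC hornerZ hornerX mulr0 addr0.
  by rewrite /p (negbTE ji) scale0r addr0 derivC mulr0.
move=> F0; apply/mpolyP => m; rewrite mcoeff0.
have : forall x : 'I_n -> K, (F^`M[m]).@[x] = 0.
  rewrite mderivm_foldr; elim: (flatten _) => //= i s IH x.
  exact: step.
move/(_ (fun=> 0)).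
have -> (G : {mpoly K[n]}) : G.@[fun=> 0] = G@_0%MM.
  elim/mpoly_algebra_ind: G => [c|i|G H hG hH|G H hG hH].
  - by rewrite mevalC mcoeffC eqxx mulr1.
  - by rewrite mevalXU mcoeffX mnm1_eq0.
  - by rewrite mevalD mcoeffD hG hH.
  - by rewrite mevalM rmorphM hG hH.
rewrite mcoeff_mderivm addm0 -mulr_natr => /eqP; rewrite mulf_eq0 => /orP[/eqP//|].
rewrite pnatr_eq0 -leqn0 leqNgt prodn_gt0 // => i.
by rewrite ffact_gt0.
Qed.

Lemma mpoly_neq0_val n (F : {mpoly K[n]}) :
  F != 0 -> exists x : 'I_n -> K, F.@[x] != 0.
Proof.
move=> F0; apply: contrapT => h; move/eqP: F0; apply; apply: mpoly_fun_eq0 => x.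
by apply: contrapT => /eqP Fx; apply: h; exists x.
Qed.

Lemma mpoly_fun_inj n (F G : {mpoly K[n]}) :
  (forall x : 'I_n -> K, F.@[x] = G.@[x]) -> F = G.
Proof.
move=> FG; apply/eqP; rewrite -subr_eq0; apply/eqP/mpoly_fun_eq0 => x.
by rewrite mevalB FG subrr.
Qed.

Lemma form_comp n m d e (F : {mpoly K[n]}) (G : 'I_n -> {mpoly K[m]}) :
  F \is d.-homog -> (forall i, G i \is e.-homog) ->
  F \mPo [tuple G i | i < n] \is (e * d).-homog.
Proof.
move=> hF hG; rewrite (comp_mpolyEX F).
rewrite big_seq; apply: rpred_sum => mm mF; apply: dhomogZ.
have <- : mdeg mm = d := dhomog_mf hF mF.
rewrite comp_mpolyX mdegE big_distrr /=.
elim/big_rec2: _ => [|i H k _ hH]; first exact: dhomog1.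
by apply: dhomogM => //; rewrite tnth_mktuple; apply: dhomogMn.
Qed.

Lemma form_scale_fun n d (F : {mpoly K[n]}) (c : K) (x : 'I_n -> K) :
  F \is d.-homog -> F.@[fun i => c * x i] = c ^+ d * F.@[x].
Proof.
move=> hF; rewrite !mevalE mulr_sumr big_seq [RHS]big_seq.
apply: eq_bigr => m mF; rewrite mulrCA; congr (_ * _).
under eq_bigr => i _ do rewrite exprMn.
have <- : mdeg m = d := dhomog_mf hF mF.
by rewrite big_split /= mdegE -expr_sum.
Qed.

Lemma form_scale n d (F : {mpoly K[n]}) (c : K) (x : 'rV[K]_n) :
  F \is d.-homog -> F.@[(c *: x) 0] = c ^+ d * F.@[x 0].
Proof.
move=> hF; rewrite -(form_scale_fun c (x 0) hF).
by apply: meval_eq => i; rewrite mxE.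
Qed.

(** The differential of F at x, applied to v: the sum through which tangent
vectors are defined. *)
Definition dif n (F : {mpoly K[n]}) (x v : 'rV[K]_n) : K :=
  \sum_i (F^`M(i)).@[x 0] * v 0 i.

Lemma difD n (F G : {mpoly K[n]}) x v : dif (F + G) x v = dif F x v + dif G x v.
Proof.
rewrite /dif -big_split /=; apply: eq_bigr => i _.
by rewrite mderivD mevalD mulrDl.
Qed.

Lemma difN n (F : {mpoly K[n]}) x v : dif (- F) x v = - dif F x v.
Proof.
rewrite /dif -sumrN; apply: eq_bigr => i _.
by rewrite mderivN mevalN mulNr.
Qed.

Lemma difB n (F G : {mpoly K[n]}) x v : dif (F - G) x v = dif F x v - dif G x v.
Proof. by rewrite difD difN. Qed.

Lemma difM n (F G : {mpoly K[n]}) x v :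
  dif (F * G) x v = dif F x v * G.@[x 0] + F.@[x 0] * dif G x v.
Proof.
rewrite /dif mulr_suml mulr_sumr -big_split /=; apply: eq_bigr => i _.
by rewrite mderivM mevalD !mevalM; ring.
Qed.

Lemma difC n c (x v : 'rV[K]_n) : dif c%:MP x v = 0.
Proof. by rewrite /dif big1 // => i _; rewrite mderivC meval0 mul0r. Qed.

Lemma difZ n c (F : {mpoly K[n]}) x v : dif (c *: F) x v = c * dif F x v.
Proof. by rewrite -mul_mpolyC difM difC mul0r add0r mevalC. Qed.

Lemma difXU n i (x v : 'rV[K]_n) : dif 'X_i x v = v 0 i.
Proof.
rewrite /dif (bigD1 i) //= big1 ?addr0 => [|j ji].
  rewrite mderivX mnm1E eqxx scale1r.
  have -> : (U_(i) - U_(i))%MM = 0%MM :> 'X_{1..n}.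
    by apply/mnmP => k; rewrite mnmBE subnn mnm0E.
  by rewrite mpolyX0 meval1 mul1r.
by rewrite mderivX mnm1E eq_sym (negbTE ji) scale0r meval0 mul0r.
Qed.

Lemma dif_sum n I (r : seq I) (F : I -> {mpoly K[n]}) x v :
  dif (\sum_(i <- r) F i) x v = \sum_(i <- r) dif (F i) x v.
Proof.
elim/big_rec2: _ => [|i a G _ <-]; last by rewrite difD.
by rewrite -(mpolyC0 n) difC.
Qed.

Lemma dif_comp n m (F : {mpoly K[n]}) (G : 'I_n -> {mpoly K[m]}) x v :
  dif (F \mPo [tuple G i | i < n]) x v =
  dif F (\row_i (G i).@[x 0]) (\row_i dif (G i) x v).
Proof.
elim/mpoly_algebra_ind: F => [c|i|F H hF hH|F H hF hH].
- by rewrite comp_mpolyC !difC.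
- by rewrite comp_mpolyXU -tnth_nth tnth_mktuple difXU mxE.
- by rewrite comp_mpolyD !difD hF hH.
- rewrite rmorphM !difM hF hH !comp_mpoly_meval.
  by congr (_ * _ + _ * _); apply: meval_eq => i; rewrite tnth_mktuple mxE.
Qed.

Lemma dif_euler n d (F : {mpoly K[n]}) x :
  F \is d.-homog -> dif F x x = d%:R * F.@[x 0].
Proof.
move=> hF; rewrite (mpolyE F) big_seq.
elim/big_rec: _ => [|m G mF hG].
  by rewrite -(mpolyC0 n) difC mevalC mulr0.
rewrite difD mevalD mulrDr hG; congr (_ + _).
rewrite difZ mevalZ mulrCA; congr (_ * _).
have <- : mdeg m = d := dhomog_mf hF mF.
rewrite /dif mdegE natr_sum mulr_suml.
apply: eq_bigr => i _; rewrite mderivX mevalZ.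
case: (posnP (m i)) => [->|mi0]; first by rewrite !mul0r.
rewrite -mulrA; congr (_ * _).
have -> : m = (m - U_(i) + U_(i))%MM.
  by rewrite submK // lep1mP -lt0n.
by rewrite addmK mpolyXD mevalM mevalXU.
Qed.

End PolynomialValues.

(** * The Nullstellensatz over an uncountable field *)

(** Formulated for maps to the integers, the way it is used: the degrees of a
family of polynomials indexed by T are bounded on an infinite set of indices. *)
Definition uncountable (T : eqType) : Prop := forall phi : T -> nat,
  exists k, forall m, exists s : seq T,
    [/\ uniq s, (m <= size s)%N & forall c, c \in s -> (phi c <= k)%N].

Definition ideal (K : comNzRingType) n (J : {mpoly K[n]} -> Prop) : Prop :=
  [/\ J 0, forall F G, J F -> J G -> J (F + G) &
      forall F G, J G -> J (F * G)].

(** A homogeneous ideal, given by its homogeneous pieces J d. *)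
Definition graded_ideal (K : comNzRingType) n
    (J : nat -> {mpoly K[n]} -> Prop) : Prop :=
  [/\ forall d F, J d F -> F \is d.-homog, forall d, J d 0,
      forall d F G, J d F -> J d G -> J d (F + G) &
      forall d e F G, F \is d.-homog -> J e G -> J (d + e)%N (F * G)].

Section Nullstellensatz.
Variable K : numClosedFieldType.
Hypothesis uncK : uncountable K.
Implicit Types (n : nat).

Lemma linear_relation n k N (q : 'I_N -> {mpoly K[n]}) :
  (forall i, msize (q i) <= k)%N -> (#|{: 'X_{1..n < k}}| < N)%N ->
  exists l : 'rV[K]_N, l != 0 /\ \sum_i l 0 i *: q i = 0.
Proof.
move=> hq hN; pose B := 'X_{1..n < k}.
pose A := \matrix_(i < N, j < #|{: B}|) (q i)@_(enum_val j : B).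
have /rowV0Pn[l lA l0] : kermx A != 0.
  rewrite kermx_eq0 -row_leq_rank -ltnNge.
  by apply: leq_ltn_trans (rank_leq_col A) hN.
exists l; split=> //; move/sub_kermxP: lA => lA.
apply/mpolyP => m; rewrite mcoeff0 raddf_sum /=.
case: (ltnP (mdeg m) k) => mk; last first.
  apply: big1 => i _; rewrite mcoeffZ memN_msupp_eq0 ?mulr0 //.
  by apply: msize_mdeg_ge; apply: leq_trans (hq i) mk.
have := congr1 (fun M : 'rV_ _ => M 0 (enum_rank (BMultinom mk))) lA.
rewrite !mxE => lA0; rewrite -[RHS]lA0; apply: eq_bigr => i _.
by rewrite mcoeffZ !mxE enum_rankK.
Qed.

(** If every 'X_i - c were invertible modulo J, with inverse q_c, then, the
field being uncountable, infinitely many of the q_c would have bounded degree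
and so satisfy a linear relation.  Clearing denominators turns that relation
into a nonzero polynomial in 'X_i alone which lies in J; it splits into factors
that are all invertible modulo J. *)
Lemma proper_ideal_specialize n (J : {mpoly K[n]} -> Prop) (i : 'I_n) :
  ideal J -> ~ J 1 ->
  exists c, forall F G, J F -> F + G * ('X_i - c%:MP) <> 1.
Proof.
move=> [J0 JD JM] J1; apply: contrapT => noc.
have inv c : exists q, J (1 - q * ('X_i - c%:MP)).
  apply: contrapT => hc; apply: noc; exists c => F G JF FG; apply: hc.
  by exists G; rewrite -FG addrK.
have [q hq] := choice inv.
have [k /(_ #|{: 'X_{1..n < k}}|.+1) [s [us ss sk]]] := uncK (fun c => msize (q c)).
have [|l [l0 lq]] := @linear_relation n k (size s) (fun j => q s`_j) _ ss.
  by move=> j; apply: sk; rewrite mem_nth.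
pose X c : {mpoly K[n]} := 'X_i - c%:MP.
pose emb := (fun p : {poly K} => (map_poly (@mpolyC n K) p).['X_i]).
pose p : {poly K} := \sum_(j < size s) l 0 j *: \prod_(h < size s | h != j) ('X - (s`_h)%:P).
have embX c : emb ('X - c%:P) = X c.
  by rewrite /emb rmorphB /= map_polyX map_polyC hornerD hornerN hornerX hornerC.
have embM a b : emb (a * b) = emb a * emb b by rewrite /emb rmorphM hornerM.
have embZ c b : emb (c *: b) = c *: emb b.
  by rewrite /emb map_polyZ hornerZ mul_mpolyC.
have embprod (I : Type) (r : seq I) (P : pred I) (f : I -> {poly K}) :
    emb (\prod_(h <- r | P h) f h) = \prod_(h <- r | P h) emb (f h).
  by apply: (big_morph emb embM); rewrite /emb rmorph1 hornerC.
have embsum (I : Type) (r : seq I) (P : pred I) (f : I -> {poly K}) :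
    emb (\sum_(h <- r | P h) f h) = \sum_(h <- r | P h) emb (f h).
  apply: (big_morph emb); last by rewrite /emb rmorph0 horner0.
  by move=> a b; rewrite /emb rmorphD hornerD.
have p0 : p != 0.
  have /rV0Pn[j lj] := l0.
  apply: contraNneq lj => pz.
  have := congr1 (fun f => f.[s`_j]) pz.
  rewrite horner0 /p horner_sum (bigD1 j) //= [X in _ + X]big1 => [|h hj].
    rewrite addr0 hornerZ => /eqP; rewrite mulf_eq0 => /orP[//|].
    rewrite horner_prod => /eqP pr0; exfalso; move/eqP: pr0; apply/negP.
    apply/prodf_neq0 => h hj; rewrite hornerXsubC subr_eq0 eq_sym.
    by rewrite nth_uniq.
  rewrite hornerZ horner_prod (bigD1 j) 1?eq_sym //= hornerXsubC subrr.
  by rewrite mul0r mulr0.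
have Jp : J (emb p).
  pose Psi := \prod_(h < size s) X s`_h.
  have -> : emb p = \sum_j (l 0 j *: \prod_(h < size s | h != j) X s`_h) *
                       (1 - q s`_j * X s`_j).
    have term (j : 'I_(size s)) :
        (l 0 j *: \prod_(h < size s | h != j) X s`_h) * (1 - q s`_j * X s`_j) =
        l 0 j *: (\prod_(h < size s | h != j) X s`_h) - (l 0 j *: q s`_j) * Psi.
      have -> : Psi = X s`_j * \prod_(h < size s | h != j) X s`_h.
        by rewrite /Psi (bigD1 j).
      by rewrite -!mul_mpolyC; ring.
    rewrite (eq_bigr _ (fun j _ => term j)).
    rewrite sumrB -mulr_suml lq mul0r subr0 /p embsum; apply: eq_bigr => j _.
    by rewrite embZ embprod; congr (_ *: _); apply: eq_bigr => h _; rewrite embX.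
  by elim/big_ind: _ => // j _; apply: (JM _ _).
have [r pE] := closed_field_poly_normal p.
have {Jp} : J (emb (\prod_(z <- r) ('X - z%:P))).
  have lp0 : lead_coef p != 0 by rewrite lead_coef_eq0.
  have := JM (lead_coef p)^-1%:MP _ Jp.
  by rewrite {2}pE embZ mul_mpolyC scalerA mulVf // scale1r.
elim: r {pE} => [|z r IH].
  by rewrite big_nil /emb rmorph1 hornerC.
rewrite big_cons embM embX => Jz; apply: IH.
set F := emb _ in Jz *.
have -> : F = F * (1 - q z * X z) + q z * (X z * F) by ring.
by apply: (JD _ _); apply: (JM _ _).
Qed.

(** Specializing the variables one after the other keeps the ideal proper, and
a proper ideal containing all 'X_i - a_i vanishes at a. *)
Lemma nullstellensatz n (J : {mpoly K[n]} -> Prop) :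
  ideal J -> (forall a : 'I_n -> K, exists F, J F /\ F.@[a] != 0) -> J 1.
Proof.
move=> idJ noz; apply: contrapT => J1.
have /(_ n (leqnn n)) : forall k, (k <= n)%N -> exists J',
    [/\ ideal J', ~ J' 1, forall F, J F -> J' F &
        forall i : 'I_n, (i < k)%N -> exists c, J' ('X_i - c%:MP)].
  elim=> [_|k IH kn]; first by exists J; split.
  have [J' [idJ' J'1 JJ' hJ']] := IH (ltnW kn).
  have [c hc] := proper_ideal_specialize (Ordinal kn) idJ' J'1.
  have [J0 JD JM] := idJ'.
  exists (fun H => exists F G, J' F /\ H = F + G * ('X_(Ordinal kn) - c%:MP)).
  split.
  - split.
    + by exists 0, 0; rewrite mul0r addr0.
    + move=> _ _ [F [G [JF ->]]] [F' [G' [JF' ->]]].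
      exists (F + F'), (G + G'); split; first exact: JD.
      by ring.
    + move=> H _ [F [G [JF ->]]]; exists (H * F), (H * G); split; first exact: JM.
      by ring.
  - by move=> [F [G [JF FG]]]; apply: (hc F G JF).
  - by move=> F JF; exists F, 0; rewrite mul0r addr0; split=> //; apply: JJ'.
  - move=> i; rewrite ltnS leq_eqVlt => /orP[/eqP ik|ik].
      exists c, 0, 1; rewrite mul1r add0r; split=> //.
      by congr ('X_ _ - _); apply: val_inj.
    have [e he] := hJ' i ik; exists e, ('X_i - e%:MP), 0.
    by rewrite mul0r addr0.
move=> [J' [[J0 JD JM] J'1 JJ' hJ']].
have [a ha] := choice (fun i => hJ' i (ltn_ord i)).
have JFa F : J' (F - F.@[a]%:MP).
  elim/mpoly_algebra_ind: F => [c|i|F G hF hG|F G hF hG].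
  - by rewrite mevalC subrr.
  - by rewrite mevalXU.
  - rewrite mevalD mpolyCD.
    have -> : F + G - (F.@[a]%:MP + G.@[a]%:MP) =
      (F - F.@[a]%:MP) + (G - G.@[a]%:MP) by ring.
    exact: JD.
  - rewrite mevalM mpolyCM.
    have -> : F * G - (F.@[a]%:MP * G.@[a]%:MP) =
      G * (F - F.@[a]%:MP) + F.@[a]%:MP * (G - G.@[a]%:MP) by ring.
    by apply: (JD _ _); apply: (JM _ _).
have [F [JF Fa]] := noz a; apply: J'1.
have -> : 1 = F.@[a]^-1%:MP * (F + (-1)%:MP * (F - F.@[a]%:MP)) :> {mpoly K[n]}.
  rewrite mpolyCN mpolyC1 mulN1r opprB addrCA subrr addr0 -mpolyCM mulVf //.
by apply: (JM _ _); apply: (JD _ _); [apply: JJ'|apply: (JM _ _)].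
Qed.

Lemma homogenize n (i : 'I_n) (F : {mpoly K[n]}) : exists e G,
  G \is e.-homog /\ forall x : 'I_n -> K, x i = 1 -> G.@[x] = F.@[x].
Proof.
have hX (j : 'I_n) : ('X_j : {mpoly K[n]}) \is 1.-homog.
  by rewrite dhomogX /= mdeg1.
have hXn k : ('X_i ^+ k : {mpoly K[n]}) \is k.-homog.
  by have := dhomogMn k (hX i); rewrite mul1n.
elim/mpoly_algebra_ind: F => [c|j|F G [d [F' [hF eF]]] [e [G' [hG eG]]]
  |F G [d [F' [hF eF]]] [e [G' [hG eG]]]].
- exists 0%N, c%:MP; split=> //.
  by rewrite -[_%:MP]mulr1 mul_mpolyC; apply: dhomogZ; exact: dhomog1.
- by exists 1%N, 'X_j.
- exists (d + e)%N, (F' * 'X_i ^+ e + G' * 'X_i ^+ d); split.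
    apply: dhomogD; first exact: dhomogM.
    by rewrite addnC; apply: dhomogM.
  move=> x xi; rewrite !mevalD !mevalM !rmorphXn /= !mevalXU xi !expr1n !mulr1.
  by rewrite eF // eG.
- exists (d + e)%N, (F' * G'); split; first exact: dhomogM.
  by move=> x xi; rewrite !mevalM eF // eG.
Qed.

(** Dehomogenizing at 'X_i reduces the claim to the affine statement; the
resulting expression of 1 is rehomogenized into a power of 'X_i. *)
Lemma graded_ideal_power n (J : nat -> {mpoly K[n]} -> Prop) (i : 'I_n) :
  graded_ideal J ->
  (forall a : 'I_n -> K, a i != 0 -> exists d F, J d F /\ F.@[a] != 0) ->
  exists N, J N ('X_i ^+ N).
Proof.
move=> [Jh J0 JD JM] noz.
have hX : ('X_i : {mpoly K[n]}) \is 1.-homog by rewrite dhomogX /= mdeg1.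
have hXn k : ('X_i ^+ k : {mpoly K[n]}) \is k.-homog.
  by have := dhomogMn k hX; rewrite mul1n.
pose J' (f : {mpoly K[n]}) := exists N F,
  J N F /\ forall x : 'I_n -> K, x i = 1 -> F.@[x] = f.@[x].
have : J' 1.
  apply: nullstellensatz.
    split.
    - by exists 0%N, 0; split.
    - move=> F G [d [F' [JF eF]]] [e [G' [JG eG]]].
      exists (e + d)%N, ('X_i ^+ e * F' + 'X_i ^+ d * G'); split.
        apply: (JD _ _ _); first exact: (JM _ _ _ _).
        by rewrite addnC; apply: (JM _ _ _ _).
      move=> x xi; rewrite !mevalD !mevalM !rmorphXn /= !mevalXU xi !expr1n.
      by rewrite !mul1r eF // eG.
    - move=> F G [e [G' [JG eG]]]; have [d [F' [hF eF]]] := homogenize i F.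
      exists (d + e)%N, (F' * G'); split; first exact: JM.
      by move=> x xi; rewrite !mevalM eF // eG.
  move=> a; case: (eqVneq (a i) 1) => ai; last first.
    exists ('X_i - 1); rewrite mevalB mevalXU meval1 subr_eq0; split=> //.
    by exists 0%N, 0; split=> // x xi; rewrite mevalB mevalXU meval1 meval0 xi subrr.
  have [|d [F [JF Fa]]] := noz a; first by rewrite ai oner_eq0.
  by exists F; split=> //; exists d, F.
move=> [N [F [JF F1]]]; exists N.+1.
suff -> : 'X_i ^+ N.+1 = 'X_i * F by apply: (JM 1%N N _ _).
apply: mpoly_fun_inj => x; rewrite mevalM rmorphXn /= mevalXU exprS.
case: (eqVneq (x i) 0) => [->|xi]; first by rewrite !mul0r.
congr (_ * _).
have -> : F.@[x] = F.@[fun j => x i * (x j / x i)].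
  by apply: meval_eq => j; rewrite mulrC divfK.
rewrite (form_scale_fun _ _ (Jh _ _ JF)) F1 ?divff //.
by rewrite meval1 mulr1.
Qed.

(** In large degree a monomial is divisible by one of the powers of variables
which lie in J. *)
Lemma graded_nullstellensatz n (J : nat -> {mpoly K[n]} -> Prop) :
  graded_ideal J ->
  (forall a : 'rV[K]_n, a != 0 -> exists d F, J d F /\ F.@[a 0] != 0) ->
  exists N, forall m : 'X_{1..n}, mdeg m = N -> J N 'X_[m].
Proof.
move=> gJ noz; have [Jh J0 JD JM] := gJ.
have pw i : exists N, J N ('X_i ^+ N).
  apply: graded_ideal_power => // a ai.
  have [|d [F [JF Fa]]] := noz (\row_j a j).
    by apply: contraNneq ai => /rowP/(_ i); rewrite !mxE => ->.
  exists d, F; split=> //.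
  by rewrite (@meval_eq _ _ _ ((\row_j a j) 0)) // => j; rewrite mxE.
have [e he] := choice pw.
exists (\sum_i e i).+1 => m md.
have [i ei] : exists i, (e i <= m i)%N.
  apply: contrapT => hn; suff : (mdeg m <= \sum_i e i)%N by rewrite md ltnn.
  rewrite mdegE; apply: leq_sum => i _; rewrite leqNgt; apply/negP => hi.
  by apply: hn; exists i; rewrite ltnW.
have mE : m = (m - U_(i) *+ e i + U_(i) *+ e i)%MM.
  rewrite submK //; apply/mnm_lepP => j; rewrite mulmnE mnm1E.
  by case: eqP => [<-|_]; rewrite ?mul1n.
have dE : mdeg m = (mdeg (m - U_(i) *+ e i) + e i)%N.
  by rewrite {1}mE mdegD mdegMn mdeg1 mul1n.
have -> : 'X_[m] = 'X_[m - U_(i) *+ e i] * 'X_i ^+ e i :> {mpoly K[n]}.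
  by rewrite mpolyXn -mpolyXD -mE.
by rewrite -md dE; apply: (JM _ _ _ _); rewrite ?dhomogX.
Qed.

End Nullstellensatz.

(** * Closed sets, regular functions and regular maps *)

Section ProjectiveGeometry.
Variable K : numClosedFieldType.
Implicit Types (n m d : nat).

Lemma same_point_scale n (u v : 'rV[K]_n) :
  (u == v)%MS -> exists2 c, c != 0 & u = c *: v.
Proof.
move=> /andP[/sub_rVP[c uE] /sub_rVP[e vE]].
case: (eqVneq c 0) => [c0|c0]; last by exists c.
exists 1; first by rewrite oner_neq0.
by rewrite scale1r uE c0 scale0r vE uE c0 scale0r scaler0.
Qed.

Lemma scale_same_point n (c : K) (v : 'rV[K]_n) : c != 0 -> (c *: v == v)%MS.
Proof. by move=> c0; apply/eqmxP; exact: eqmx_scale. Qed.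

Lemma same_point_refl n (u : 'rV[K]_n) : (u == u)%MS.
Proof. by rewrite submx_refl. Qed.

Lemma same_point_sym n (u v : 'rV[K]_n) : (u == v)%MS -> (v == u)%MS.
Proof. by rewrite andbC. Qed.

Lemma same_point_trans n (u v w : 'rV[K]_n) :
  (u == v)%MS -> (v == w)%MS -> (u == w)%MS.
Proof. by move=> /eqmxP uv /eqmxP vw; apply/eqmxP; apply: eqmx_trans uv vw. Qed.

Lemma same_point_neq0 n (u v : 'rV[K]_n) : (u == v)%MS -> (u != 0) = (v != 0).
Proof.
by move=> /same_point_scale[c c0 ->]; rewrite scaler_eq0 (negbTE c0).
Qed.

Lemma same_point_mul n m (u v : 'rV[K]_n) (A : 'M[K]_(n, m)) :
  (u == v)%MS -> (u *m A == v *m A)%MS.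
Proof.
by move=> /same_point_scale[c c0 ->]; rewrite -scalemxAl; exact: scale_same_point.
Qed.

Lemma form_same_point n d (F : {mpoly K[n]}) (x y : 'rV[K]_n) :
  F \is d.-homog -> (x == y)%MS -> F.@[x 0] = 0 -> F.@[y 0] = 0.
Proof.
move=> hF /same_point_sym/same_point_scale[c c0 ->].
by rewrite (form_scale _ _ hF) => ->; rewrite mulr0.
Qed.

Lemma var_form n (i : 'I_n) : ('X_i : {mpoly K[n]}) \is 1.-homog.
Proof. by rewrite dhomogX /= mdeg1. Qed.

Definition linform n (a : 'cV[K]_n) : {mpoly K[n]} := \sum_i a i 0 *: 'X_i.

Lemma linform_form n (a : 'cV[K]_n) : linform a \is 1.-homog.
Proof. by apply: rpred_sum => i _; apply: dhomogZ; apply: var_form. Qed.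

Lemma linformE n (a : 'cV[K]_n) (x : 'rV[K]_n) :
  (linform a).@[x 0] = (x *m a) 0 0.
Proof.
rewrite /linform raddf_sum /= mxE; apply: eq_bigr => i _.
by rewrite mevalZ mevalXU mulrC.
Qed.

Lemma dif_linform n (a : 'cV[K]_n) (x v : 'rV[K]_n) :
  dif (linform a) x v = (v *m a) 0 0.
Proof.
rewrite /linform dif_sum mxE; apply: eq_bigr => i _.
by rewrite difZ difXU mulrC.
Qed.

Lemma pclosed_neq0 n (X : pset K n) x : pclosed X -> X x -> x != 0.
Proof. by move=> [S [_ XE]] /XE[]. Qed.

Lemma pclosed_same_point n (X : pset K n) x y :
  pclosed X -> (x == y)%MS -> X x -> X y.
Proof.
move=> [S [hS XE]] xy /XE[x0 xS]; apply/XE; split.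
  by rewrite -(same_point_neq0 xy).
by move=> F SF; have [d hF] := hS F SF; apply: (form_same_point hF xy); apply: xS.
Qed.

Lemma pclosed_separate n (X : pset K n) x : pclosed X -> x != 0 -> ~ X x ->
  exists d F, [/\ F \is d.-homog, forall y, X y -> F.@[y 0] = 0 & F.@[x 0] != 0].
Proof.
move=> [S [hS XE]] x0 Xx; apply: contrapT => hn; apply: Xx; apply/XE.
split=> // F SF; have [d hF] := hS F SF; apply: contrapT => /eqP Fx.
by apply: hn; exists d, F; split=> // y /XE[_]; apply.
Qed.

(** The converse of separation: the forms vanishing on X then define X. *)
Lemma pclosed_intro n (X : pset K n) : (forall x, X x -> x != 0) ->
  (forall x, x != 0 -> ~ X x -> exists d F,
    [/\ F \is d.-homog, forall y, X y -> F.@[y 0] = 0 & F.@[x 0] != 0]) ->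
  pclosed X.
Proof.
move=> X0 sep.
exists (fun F => (exists d, F \is d.-homog) /\ forall y, X y -> F.@[y 0] = 0).
split=> [F []//|x]; split=> [Xx|[x0 xS]]; first by split=> [|F [_]]; [exact: X0|exact].
apply: contrapT => Xx; have [d [F [hF XF]]] := sep x x0 Xx; apply/negP.
by rewrite negbK xS //; split=> //; exists d.
Qed.

Lemma pclosedU n (A B : pset K n) :
  pclosed A -> pclosed B -> pclosed (fun x => A x \/ B x).
Proof.
move=> cA cB; apply: pclosed_intro => [x [/(pclosed_neq0 cA)|/(pclosed_neq0 cB)]//|].
move=> x x0 ABx; have [|d [F [hF FA Fx]]] := pclosed_separate cA x0.
  by move=> Ax; apply: ABx; left.
have [|e [G [hG GB Gx]]] := pclosed_separate cB x0.
  by move=> Bx; apply: ABx; right.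
exists (d + e)%N, (F * G); split; first exact: dhomogM.
  by move=> y [/FA|/GB] yE; rewrite mevalM yE ?mul0r ?mulr0.
by rewrite mevalM mulf_neq0.
Qed.

Lemma pclosed0 n : pclosed (fun _ : 'rV[K]_n.+1 => False).
Proof.
apply: pclosed_intro => // x _ _; exists 0%N, 1; split=> //.
  exact: dhomog1.
by rewrite meval1 oner_neq0.
Qed.

Lemma irreducible_finite_cover n (X : pset K n) (T : eqType) (s : seq T)
    (A : T -> pset K n) :
  irreducible X -> (forall c, c \in s -> pclosed (A c)) ->
  (forall x, X x -> exists2 c, c \in s & A c x) ->
  exists2 c, c \in s & psubset X (A c).
Proof.
move=> [[x0 Xx0] irr]; elim: s => [|c s IH] cA XA; first by have [] := XA x0 Xx0.
have cU (t : seq T) : (forall e, e \in t -> pclosed (A e)) ->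
    pclosed (fun x => exists2 e, e \in t & A e x).
  elim: t => [|e t IHt] ct.
    suff -> : (fun x => exists2 e, e \in [::] & A e x) = (fun=> False) by exact: pclosed0.
    by apply/predeqP => x; split=> // -[].
  suff -> : (fun x => exists2 f, f \in e :: t & A f x) =
      (fun x => A e x \/ exists2 f, f \in t & A f x).
    apply: pclosedU; first by apply: ct; rewrite mem_head.
    by apply: IHt => f ft; apply: ct; rewrite inE ft orbT.
  apply/predeqP => x; split=> [[f]|[Ae|[f ft Af]]].
  - by rewrite inE => /orP[/eqP->|ft] Af; [left|right; exists f].
  - by exists e; rewrite ?mem_head.
  - by exists f; rewrite // inE ft orbT.
have cs : forall e, e \in s -> pclosed (A e).
  by move=> e es; apply: cA; rewrite inE es orbT.
have [| |XAc|XAs] := irr (A c) _ _ (cU s cs).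
- by apply: cA; rewrite mem_head.
- move=> x /XA[e]; rewrite inE => /orP[/eqP->|es] Ae; first by left.
  by right; exists e.
- by exists c; rewrite ?mem_head.
- have [|e es XAe] := IH cs; first by move=> x /XAs.
  by exists e; rewrite // inE es orbT.
Qed.

Definition degree_mon n N (j : 'I_#|{: 'X_{1..n < N.+1}}|) : 'X_{1..n} :=
  val (enum_val j : 'X_{1..n < N.+1}).

(** Monomials of degree less than N index this row as well, with entry 0, because
the finite type of exponents is only bounded from above. *)
Definition monomial_row n N (x : 'rV[K]_n) : 'rV[K]_#|{: 'X_{1..n < N.+1}}| :=
  \row_j if mdeg (degree_mon j) == N then 'X_[degree_mon j].@[x 0] else 0.

Lemma degree_mon_inj n N : injective (@degree_mon n N).
Proof. by move=> i j /val_inj/enum_val_inj. Qed.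

Lemma monomial_row_neq0 n N (x : 'rV[K]_n) : x != 0 -> monomial_row N x != 0.
Proof.
move=> /rV0Pn[i xi].
have bd : (mdeg (U_(i) *+ N)%MM < N.+1)%N by rewrite mdegMn mdeg1 mul1n.
apply/rV0Pn; exists (enum_rank (BMultinom bd)).
rewrite mxE /degree_mon enum_rankK /= mdegMn mdeg1 mul1n eqxx -mpolyXn rmorphXn /=.
by rewrite mevalXU expf_neq0.
Qed.

Lemma form_monomial_row n N (F : {mpoly K[n]}) (x : 'rV[K]_n) : F \is N.-homog ->
  F.@[x 0] = \sum_j monomial_row N x 0 j * F@_(degree_mon j).
Proof.
move=> hF; have szF : (msize F <= N.+1)%N.
  rewrite msizeE; apply/bigmax_leqP_seq => m mP _.
  by have -> : mdeg m = N := dhomog_mf hF mP.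
rewrite {1}(mpolywE szF) raddf_sum /=.
rewrite (reindex (fun i : 'I_#|{: 'X_{1..n < N.+1}}| =>
  enum_val i : 'X_{1..n < N.+1})) /=; last first.
  by exists enum_rank => i _; rewrite ?enum_valK ?enum_rankK.
apply: eq_bigr => j _; rewrite !mxE mevalZ mulrC -/(degree_mon j).
case: ifP => [//|/negbT mj].
by rewrite (dhomog_nemf_coeff hF mj) mulr0 mul0r.
Qed.

(** The quotient P / Q is cleared of its denominator, so that the identity is a
condition on all of X, including the zeros of Q. *)
Definition regular_function n (X : pset K n) (f : 'rV[K]_n.+1 -> K) : Prop :=
  forall x, X x -> exists d P Q, [/\ P \is d.-homog, Q \is d.-homog,
    Q.@[x 0] != 0 & forall y, X y -> f y * Q.@[y 0] = P.@[y 0]].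

(** The denominators of f generate, together with the forms vanishing on X, a
graded ideal without zeros, which therefore contains all monomials of some
degree N.  Multiplication by f then acts on the vector of these monomials by a
constant matrix, so the values of f are eigenvalues of that matrix: there are
finitely many, and irreducibility leaves only one. *)
Lemma regular_function_const n (X : pset K n) f : uncountable K ->
  pclosed X -> irreducible X -> regular_function X f ->
  exists c, forall x, X x -> f x = c.
Proof.
move=> uncK cX irX regf.
pose J d (F : {mpoly K[n.+1]}) := F \is d.-homog /\ exists P,
  P \is d.-homog /\ forall y, X y -> f y * F.@[y 0] = P.@[y 0].
have gJ : graded_ideal J.
  split.
  - by move=> d F [].
  - move=> d; split; first exact: dhomog0.
    by exists 0; split; [exact: dhomog0|move=> y _; rewrite !meval0 mulr0].
  - move=> d F G [hF [P [hP fP]]] [hG [Q [hQ fQ]]]; split; first exact: dhomogD.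
    exists (P + Q); split; first exact: dhomogD.
    by move=> y Xy; rewrite !mevalD mulrDr fP // fQ.
  - move=> d e F G hF [hG [Q [hQ fQ]]]; split; first exact: dhomogM.
    exists (F * Q); split; first exact: dhomogM.
    by move=> y Xy; rewrite !mevalM mulrCA fQ.
have [|N hN] := graded_nullstellensatz uncK gJ.
  move=> a a0; case: (pselect (X a)) => Xa.
    have [d [P [Q [hP hQ Qa fQ]]]] := regf a Xa.
    by exists d, Q; split=> //; split=> //; exists P.
  have [d [F [hF FX Fa]]] := pclosed_separate cX a0 Xa.
  exists d, F; split=> //; split=> //; exists 0; split; first exact: dhomog0.
  by move=> y Xy; rewrite FX // mulr0 meval0.
have hN' (m : 'X_{1..n.+1}) : exists P, mdeg m = N ->
    P \is N.-homog /\ forall y, X y -> f y * 'X_[m].@[y 0] = P.@[y 0].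
  case: (eqVneq (mdeg m) N) => [md|/eqP md]; last by exists 0.
  by have [_ [P hP]] := hN m md; exists P.
have [P hP] := choice hN'.
pose B := #|{: 'X_{1..n.+1 < N.+1}}|.
pose M := \matrix_(i < B, j < B)
  if mdeg (degree_mon j) == N then (P (degree_mon j))@_(degree_mon i) else 0.
have [r rE] := closed_field_poly_normal (char_poly M).
have fr x : X x -> f x \in r.
  move=> Xx; suff : root (char_poly M) (f x).
    by rewrite rE (monicP (char_poly_monic M)) scale1r root_prod_XsubC.
  rewrite -eigenvalue_root_char; apply/eigenvalueP; exists (monomial_row N x).
    apply/rowP => j; rewrite mxE [RHS]mxE [in RHS]mxE; case: ifP => mj; last first.
      by rewrite mulr0 big1 // => i _; rewrite [M _ _]mxE mj mulr0.
    have [hPj ->//] := hP _ (eqP mj).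
    rewrite (form_monomial_row _ hPj); apply: eq_bigr => i _.
    by rewrite [M _ _]mxE mj.
  by apply: monomial_row_neq0; apply: pclosed_neq0 Xx.
have [||c cr Xc] := @irreducible_finite_cover _ _ _ r (fun c x => X x /\ f x = c) irX.
- move=> c _; apply: pclosed_intro => [x [/(pclosed_neq0 cX)]//|x x0 Xfx].
  case: (pselect (X x)) => Xx; last first.
    have [d [F [hF FX Fx]]] := pclosed_separate cX x0 Xx.
    by exists d, F; split=> // y [/FX].
  have [d [R [Q [hR hQ Qx fQ]]]] := regf x Xx.
  exists d, (R - c *: Q); split.
  + by rewrite rpredB // dhomogZ.
  + by move=> y [Xy fy]; rewrite mevalB mevalZ -fQ // fy subrr.
  + rewrite mevalB mevalZ -fQ // -mulrBl mulf_neq0 // subr_eq0.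
    by apply/eqP => fx; apply: Xfx.
- by move=> x Xx; exists (f x); [exact: fr|].
by exists c => x /Xc[].
Qed.

(** The map f may send the coordinate vectors of a point to unrelated multiples of
each other, but to the same point: the forms representing f near x only scale. *)
Lemma regular_same_point n m (X : pset K n) (f : 'rV[K]_n.+1 -> 'rV[K]_m.+1) x y :
  pclosed X -> regular X f -> X x -> (x == y)%MS -> (f x == f y)%MS.
Proof.
move=> cX regf Xx xy; have Xy := pclosed_same_point cX xy Xx.
have [d [F [hF Fx Ff]]] := regf x Xx.
have [c c0 yE] := same_point_scale (same_point_sym xy).
have Fy : poly_map F y = c ^+ d *: poly_map F x.
  by apply/rowP => i; rewrite !mxE yE (form_scale _ _ (hF i)).
have cd0 : c ^+ d != 0 by rewrite expf_neq0.
apply: same_point_trans (Ff x Xx Fx) _; apply: same_point_sym.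
apply: same_point_trans (Ff y Xy _) _; rewrite Fy ?scaler_eq0 ?negb_or ?cd0 //.
exact: scale_same_point.
Qed.

End ProjectiveGeometry.

(** * Tangent vectors and local parameters of smooth curves *)

Section LocalParameter.
Variable K : numClosedFieldType.
Implicit Types (n m d : nat).

Lemma row_free_extend m n (A : 'M[K]_(m, n)) (u : 'rV[K]_n) :
  row_free A -> ~~ (u <= A)%MS -> row_free (col_mx A u).
Proof.
move=> fA uA; rewrite /row_free eqn_leq (rank_leq_row (col_mx A u)) /=.
have hlt : (\rank A < \rank (A + u)%MS)%N.
  rewrite (ltn_leqif (mxrank_leqif_sup (addsmxSl A u))).
  by apply: contra uA => uA; apply: submx_trans uA; exact: addsmxSr.
by move: hlt; rewrite (addsmxE A u) (eqP fA); move: (\rank (col_mx A u)) => r; rewrite addn1.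
Qed.

Lemma row_free_row n (u : 'rV[K]_n) : u != 0 -> row_free u.
Proof. by move=> u0; rewrite /row_free rank_rV u0. Qed.

Lemma row_free_pair n (u w : 'rV[K]_n) :
  u != 0 -> (forall c, w <> c *: u) -> row_free (col_mx u w).
Proof.
move=> u0 wu; apply: row_free_extend; first exact: row_free_row.
by apply/negP => /sub_rVP[c]; exact: wu.
Qed.

Lemma sub_pair n (u v w : 'rV[K]_n) :
  (u <= col_mx v w)%MS -> exists a b, u = a *: v + b *: w.
Proof.
move=> /submxP[D ->]; exists (lsubmx D 0 0), (rsubmx D 0 0).
rewrite -{1}[D]hsubmxK mul_row_col.
by rewrite {1}[lsubmx D]mx11_scalar {1}[rsubmx D]mx11_scalar !mul_scalar_mx.
Qed.

(** A linearly independent family in W of maximal size spans W. *)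
Lemma subspace_matrix n (W : 'rV[K]_n -> Prop) :
  W 0 -> (forall u v, W u -> W v -> W (u + v)) -> (forall c u, W u -> W (c *: u)) ->
  exists m (A : 'M[K]_(m, n)), forall u, W u <-> (u <= A)%MS.
Proof.
move=> W0 WD WZ.
pose P r := `[< exists A : 'M[K]_(r, n), row_free A /\ forall u, (u <= A)%MS -> W u >].
have exP : exists r, P r.
  exists 0%N; apply/asboolP; exists (0 : 'M_(0, n)); split; first by rewrite /row_free mxrank0.
  by move=> u /submxP[D ->]; rewrite [D]thinmx0 mul0mx.
have bP r : P r -> (r <= n)%N.
  by move=> /asboolP[A [/eqP rA _]]; rewrite -rA; exact: rank_leq_col.
have [r /asboolP[A [fA AW]] maxr] := ex_maxnP exP bP.
exists r, A => u; split=> [Wu|/AW//]; apply: contrapT => /negP uA.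
suff : P (r + 1)%N by move/maxr; rewrite addn1 ltnn.
apply/asboolP; exists (col_mx A u); split; first exact: row_free_extend.
move=> w; rewrite -(addsmxE A u) => /sub_addsmxP[[D1 D2] /= ->].
apply: WD; first by apply: AW; rewrite submxMl.
by rewrite [D2]mx11_scalar mul_scalar_mx; apply: WZ.
Qed.

Lemma line_complement n (L : 'M[K]_(2, n)) (y : 'rV[K]_n) :
  row_free L -> y != 0 -> (y <= L)%MS ->
  exists z, [/\ (z <= L)%MS, forall c, z <> c *: y &
    forall x : 'rV_n, (x <= L)%MS -> exists a b, x = a *: y + b *: z].
Proof.
move=> fL y0 yL.
have [i hi] : exists i, ~~ (row i L <= y)%MS.
  apply: contrapT => hn; have Ls : (L <= y)%MS.
    by apply/row_subP => i; apply: contrapT => /negP hi; apply: hn; exists i.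
  by have := mxrankS Ls; rewrite (eqP fL) rank_rV; case: (y != 0).
have iy : forall c, row i L <> c *: y.
  by move=> c hc; move/negP: hi; apply; rewrite hc scalemx_sub.
exists (row i L); split=> // [|x xL]; first exact: row_sub.
apply: sub_pair; apply: submx_trans xL _.
have ML : (col_mx y (row i L) <= L)%MS by rewrite col_mx_sub yL row_sub.
by rewrite -(mxrank_leqif_sup ML) (eqP (row_free_pair y0 iy)) (eqP fL).
Qed.

Lemma form0_const n (F : {mpoly K[n]}) : F \is 0.-homog -> F = (F@_0%MM)%:MP.
Proof.
move=> hF; apply/mpolyP => m; rewrite mcoeffC.
case: (eqVneq m 0%MM) => [->|m0]; first by rewrite mulr1.
by rewrite mulr0 (dhomog_nemf_coeff hF) //= mdeg_eq0.
Qed.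

Lemma form_mderiv n d (F : {mpoly K[n]}) i :
  F \is d.+1.-homog -> F^`M(i) \is d.-homog.
Proof.
move=> hF; apply/dhomogP => m; rewrite mcoeff_msupp mcoeff_deriv => Fm.
have : F@_(m + U_(i)) != 0 by apply: contraNneq Fm => ->; rewrite mul0rn.
rewrite -mcoeff_msupp => /(dhomog_mf hF); rewrite /= mdegD mdeg1 addn1.
by move=> [].
Qed.

Lemma form_euler n d (F : {mpoly K[n]}) :
  F \is d.-homog -> \sum_i F^`M(i) * 'X_i = d%:R *: F.
Proof.
move=> hF; apply: mpoly_fun_inj => x.
pose y := \row_i x i.
have xy G : G.@[x] = G.@[y 0] by apply: meval_eq => i; rewrite mxE.
rewrite !xy mevalZ -(dif_euler _ hF) raddf_sum /=; apply: eq_bigr => i _.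
by rewrite mevalM mevalXU.
Qed.

(** Taylor expansion at s in the local coordinates 'X_k - s_k h, by recursion on
the degree: Euler's formula expresses F through its derivatives, and the
combination of derivatives that multiplies h is again a form, of smaller degree
and with the same value at s. *)
Lemma form_taylor n d (F : {mpoly K[n]}) (s : 'rV[K]_n) (h : 'cV[K]_n) :
  (s *m h) 0 0 = 1 -> F \is d.+1.-homog ->
  exists G : 'I_n -> {mpoly K[n]}, (forall k, G k \is d.-homog) /\
    F = F.@[s 0] *: linform h ^+ d.+1 + \sum_k ('X_k - s 0 k *: linform h) * G k.
Proof.
move=> sh; elim: d F => [|d IH] F hF.
  exists (fun k => F^`M(k)); split; first by move=> k; apply: form_mderiv.
  have FE := form_euler hF; rewrite scale1r in FE.
  have Fs : F.@[s 0] *: linform h ^+ 1 = \sum_k (s 0 k *: linform h) * F^`M(k).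
    rewrite -(mul1r F.@[s 0]) -(dif_euler s hF) /dif scaler_suml.
    apply: eq_bigr => k _.
    rewrite {2}(form0_const (form_mderiv k hF)) {1}(form0_const (form_mderiv k hF)).
    by rewrite mevalC expr1 -!mul_mpolyC mpolyCM; ring.
  rewrite Fs -big_split /= -{1}FE; apply: eq_bigr => k _.
  by rewrite mulrBl addrC subrK mulrC.
pose c : K := d.+2%:R^-1.
have c0 : d.+2%:R != 0 :> K by rewrite pnatr_eq0.
pose F' := \sum_k (c * s 0 k) *: F^`M(k).
have hF' : F' \is d.+1.-homog.
  by apply: rpred_sum => k _; apply: dhomogZ; apply: form_mderiv.
have F's : F'.@[s 0] = F.@[s 0].
  rewrite /F' raddf_sum /= -[RHS]mul1r -(mulVf c0) -mulrA -(dif_euler s hF).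
  rewrite mulr_sumr; apply: eq_bigr => k _; rewrite mevalZ -mulrA; congr (_ * _).
  by rewrite mulrC.
have [G [hG F'E]] := IH F' hF'.
exists (fun k => linform h * G k + c *: F^`M(k)); split.
  move=> k; apply: dhomogD; first exact: (dhomogM (linform_form h) (hG k)).
  by apply: dhomogZ; apply: form_mderiv.
have FE : F = linform h * F' + \sum_k ('X_k - s 0 k *: linform h) * (c *: F^`M(k)).
  have FE : F = c *: \sum_k F^`M(k) * 'X_k.
    by rewrite (form_euler hF) scalerA mulVf // scale1r.
  rewrite {1}FE /F' mulr_sumr scaler_sumr -big_split /=; apply: eq_bigr => k _.
  by rewrite -!mul_mpolyC mpolyCM; ring.
rewrite {1}FE {1}F'E F's mulrDr -scalerAr -exprS -addrA; congr (_ + _).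
rewrite mulr_sumr -big_split /=; apply: eq_bigr => k _.
by rewrite mulrDr mulrCA.
Qed.

Lemma det_form n N d (A : 'M[{mpoly K[n]}]_N) :
  (forall i j, A i j \is d.-homog) -> \det A \is (N * d).-homog.
Proof.
move=> hA; apply: rpred_sum => s _; rewrite -signr_odd mulr_sign.
have hprod : \prod_i A i (s i) \is (N * d).-homog.
  have -> : (N * d = \sum_(i < N) d)%N by rewrite sum_nat_const card_ord.
  elim/big_rec2: _ => [|i H k _ hH]; first exact: dhomog1.
  exact: dhomogM.
by case: ifP => _; rewrite ?rpredN.
Qed.

Lemma tangent_point n (X : pset K n) s : X s -> tangent X s s.
Proof.
move=> Xs F d hF FX; rewrite -/(dif F s s) (dif_euler s hF) FX //.
by rewrite mulr0.
Qed.

Lemma tangent_line n (X : pset K n) s : pclosed X -> smooth X 1 -> X s ->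
  exists v, [/\ tangent X s v, forall c, v <> c *: s &
    forall u, tangent X s u -> exists a b, u = a *: s + b *: v].
Proof.
move=> cX smX Xs; have s0 := pclosed_neq0 cX Xs.
have [T [fT hT]] := smX s Xs.
have sT : (s <= T)%MS by apply/hT; exact: tangent_point.
have [v [vT vs hv]] := line_complement fT s0 sT.
by exists v; split=> // [|u /hT/hv]; first by apply/hT.
Qed.

(** The differentials at s of the forms vanishing on X fill the annihilator of
the tangent space, because they form a linear subspace whose own annihilator is
the tangent space; forms of different degrees are compared by multiplying with
powers of a linear form which is 1 at s. *)
Lemma annihilator_differential n (X : pset K n) s (h a : 'cV[K]_n.+1) :
  X s -> (s *m h) 0 0 = 1 ->
  (forall u, tangent X s u -> (u *m a) 0 0 = 0) ->
  exists d F, [/\ F \is d.+1.-homog, forall x, X x -> F.@[x 0] = 0 &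
    forall u, dif F s u = (u *m a) 0 0].
Proof.
move=> Xs sh ta.
have hXk e : linform h ^+ e \is e.-homog.
  by have := dhomogMn e (linform_form h); rewrite mul1n.
have hs e : (linform h ^+ e).@[s 0] = 1.
  by rewrite rmorphXn /= linformE sh expr1n.
have dmul (F : {mpoly K[n.+1]}) e u : (forall x, X x -> F.@[x 0] = 0) ->
    dif (F * linform h ^+ e) s u = dif F s u.
  by move=> FX; rewrite difM hs mulr1 FX // mul0r addr0.
pose W (b : 'rV[K]_n.+1) := exists d F, [/\ F \is d.+1.-homog,
  forall x, X x -> F.@[x 0] = 0 & forall u, dif F s u = (u *m b^T) 0 0].
have [|||m [A WA]] := @subspace_matrix _ W.
- exists 0%N, 0; split=> [|x _|u]; first exact: dhomog0; first by rewrite meval0.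
  by rewrite -(mpolyC0 n.+1) difC trmx0 mulmx0 mxE.
- move=> b c [d [F [hF FX Fb]]] [e [G [hG GX Gc]]].
  exists (d + e)%N, (F * linform h ^+ e + G * linform h ^+ d); split.
  + apply: dhomogD; first exact: (dhomogM hF).
    by rewrite addnC; apply: (dhomogM hG).
  + by move=> x Xx; rewrite mevalD !mevalM FX // GX // !mul0r addr0.
  + move=> u; rewrite difD !dmul // Fb Gc.
    by rewrite linearD /= mulmxDr [in RHS]mxE.
- move=> c b [d [F [hF FX Fb]]]; exists d, (c *: F); split.
  + exact: dhomogZ.
  + by move=> x Xx; rewrite mevalZ FX // mulr0.
  + by move=> u; rewrite difZ Fb linearZ /= -scalemxAr [in RHS]mxE.
suff : W a^T by move=> [d [F [hF FX Fa]]]; exists d, F; split=> // u; rewrite Fa trmxK.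
apply/WA; rewrite submxE; apply/eqP/matrixP => i j; rewrite ord1 [RHS]mxE.
pose u := (col j (cokermx A))^T.
suff : (u *m a) 0 0 = 0.
  rewrite !mxE => uE; rewrite -[RHS]uE; apply: eq_bigr => k _.
  by rewrite !mxE mulrC.
apply: ta => F d hF FX; rewrite -/(dif F s u).
pose g : 'rV[K]_n.+1 := \row_k (F^`M(k)).@[s 0].
have gA : (g <= A)%MS.
  apply/WA; exists d, (F * linform h); split.
  + by rewrite -[d.+1]addn1; apply: dhomogM => //; exact: linform_form.
  + by move=> x Xx; rewrite mevalM FX // mul0r.
  + move=> w; rewrite -(expr1 (linform h)) dmul // /dif mxE; apply: eq_bigr => k _.
    by rewrite !mxE mulrC.
have := submxP gA => -[D gE].
have : (g *m col j (cokermx A)) 0 0 = 0.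
  rewrite (_ : g *m _ = D *m (A *m cokermx A) *m delta_mx j 0); last first.
    by rewrite colE gE !mulmxA.
  by rewrite mulmx_coker mulmx0 mul0mx mxE.
by rewrite !mxE => <-; apply: eq_bigr => k _; rewrite !mxE.
Qed.

(** The linear form tau is a local parameter at s, with v the tangent vector dual
to it: forms vanishing at s are divisible by tau up to the common denominator Q,
and the value of the quotient at s is the derivative along v. *)
Definition local_param n (X : pset K n) (s v : 'rV[K]_n.+1) (tau : 'cV[K]_n.+1)
    e (Q : {mpoly K[n.+1]}) : Prop :=
  [/\ Q \is e.-homog, Q.@[s 0] != 0 &
    forall d F, F \is d.+1.-homog -> F.@[s 0] = 0 -> exists E,
      [/\ E \is (e + d).-homog, E.@[s 0] = Q.@[s 0] * dif F s v &
        forall x, X x -> Q.@[x 0] * F.@[x 0] = (x *m tau) 0 0 * E.@[x 0]]].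

(** Forms vanishing on X have differentials at s prescribed to be the coordinate
functions modulo tau; their Taylor expansions are linear equations for the local
coordinates, with coefficient matrix the identity at s, and Cramer's rule
expresses the coordinates as multiples of tau near s. *)
Lemma local_parameter n (X : pset K n) s : pclosed X -> smooth X 1 -> X s ->
  exists v (tau : 'cV[K]_n.+1) e Q,
    [/\ tangent X s v, forall c, v <> c *: s, (s *m tau) 0 0 = 0 &
        (v *m tau) 0 0 = 1] /\ local_param X s v tau e Q.
Proof.
move=> cX smX Xs; have s0 := pclosed_neq0 cX Xs.
have [v [tv vs Tv]] := tangent_line cX smX Xs.
have fM := row_free_pair s0 vs.
pose B := pinvmx (col_mx s v).
have MB : col_mx s v *m B = 1%:M by apply: mulmxVp.
pose h := col (lshift 1 ord0 : 'I_(1 + 1)) B.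
pose tau := col (rshift 1 ord0 : 'I_(1 + 1)) B.
have mb (i j : 'I_(1 + 1)) : (row i (col_mx s v) *m col j B) 0 0 = (i == j)%:R.
  by rewrite colE mulmxA -row_mul MB -colE !mxE.
have rs : row (lshift 1 ord0) (col_mx s v) = s by apply/rowP => k; rewrite mxE col_mxEu.
have rv : row (rshift 1 ord0) (col_mx s v) = v by apply/rowP => k; rewrite mxE col_mxEd.
have sh : (s *m h) 0 0 = 1 by rewrite -rs mb.
have st : (s *m tau) 0 0 = 0 by rewrite -rs mb.
have vt : (v *m tau) 0 0 = 1 by rewrite -rv mb.
have hXk e : linform h ^+ e \is e.-homog.
  by have := dhomogMn e (linform_form h); rewrite mul1n.
have hs e : (linform h ^+ e).@[s 0] = 1.
  by rewrite rmorphXn /= linformE sh expr1n.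
pose l k : 'cV[K]_n.+1 := delta_mx k 0 - s 0 k *: h.
have lE (x : 'rV[K]_n.+1) k : (x *m l k) 0 0 = x 0 k - s 0 k * (x *m h) 0 0.
  by rewrite /l mulmxBr -scalemxAr -colE !mxE.
pose L k : {mpoly K[n.+1]} := 'X_k - s 0 k *: linform h.
have LE (x : 'rV[K]_n.+1) k : (L k).@[x 0] = (x *m l k) 0 0.
  by rewrite lE /L mevalB mevalXU mevalZ linformE.
have Ls k : (L k).@[s 0] = 0 by rewrite LE lE sh mulr1 subrr.
have dL u k : dif (L k) s u = (u *m l k) 0 0.
  by rewrite lE /L difB difXU difZ dif_linform.
(* The coordinate l j minus its derivative along v times tau: this kills s and v,
   hence all tangent vectors. *)
pose a j : 'cV[K]_n.+1 := l j - (v *m l j) 0 0 *: tau.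
have aE (x : 'rV[K]_n.+1) j :
    (x *m a j) 0 0 = (x *m l j) 0 0 - (v *m l j) 0 0 * (x *m tau) 0 0.
  by rewrite /a mulmxBr -scalemxAr !mxE.
have /choice[dd hdd] : forall j, exists d, exists F, [/\ F \is d.+1.-homog,
    forall x, X x -> F.@[x 0] = 0 & forall u, dif F s u = (u *m a j) 0 0].
  move=> j; apply: (annihilator_differential Xs sh) => u /Tv[b [c ->]].
  have sl : (s *m l j) 0 0 = 0 by rewrite -LE Ls.
  rewrite mulmxDl -!scalemxAl [LHS]mxE [X in X + _]mxE [X in _ + X]mxE !aE st vt sl.
  by rewrite mulr0 mulr1 !subrr !mulr0 addr0.
have [F hF] := choice hdd.
pose D := (\sum_j dd j)%N.
have ddD j : (dd j <= D)%N by rewrite /D (bigD1 j) //= leq_addr.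
pose F' j := F j * linform h ^+ (D - dd j).
have F'X j x : X x -> (F' j).@[x 0] = 0.
  by move=> Xx; have [_ FX _] := hF j; rewrite mevalM FX // mul0r.
have hF' j : F' j \is D.+1.-homog.
  have [hFj _ _] := hF j.
  have -> : D.+1 = ((dd j).+1 + (D - dd j))%N by rewrite addSn subnKC.
  exact: dhomogM.
have dF' j u : dif (F' j) s u = (u *m a j) 0 0.
  by have [_ FX Fd] := hF j; rewrite difM hs mulr1 FX // mul0r addr0.
have /choice[G hG] : forall j, exists Gj : 'I_n.+1 -> {mpoly K[n.+1]},
    (forall k, Gj k \is D.-homog) /\ F' j = \sum_k L k * Gj k.
  move=> j; have [Gj [hGj Fj]] := form_taylor sh (hF' j).
  by exists Gj; split=> //; rewrite {1}Fj F'X // scale0r add0r.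
have Gs j (x : 'rV[K]_n.+1) :
    \sum_k (G j k).@[s 0] * (x *m l k) 0 0 = (x *m a j) 0 0.
  rewrite -dF' (proj2 (hG j)) dif_sum; apply: eq_bigr => k _.
  by rewrite difM Ls mul0r addr0 dL mulrC.
(* Row G j applied to the coordinates L k is F' j, which vanishes on X.  Replacing
   the constants G j k (s) by those of the identity matrix changes it by h ^ D times
   the difference of l j and a j, a multiple of tau. *)
pose c : 'M[{mpoly K[n.+1]}]_n.+1 := \matrix_(j, k)
  (G j k + ((j == k)%:R - (G j k).@[s 0]) *: linform h ^+ D).
have cE j k : c j k = G j k + ((j == k)%:R - (G j k).@[s 0]) *: linform h ^+ D.
  by rewrite mxE.
have hc j k : c j k \is D.-homog.
  by rewrite cE; apply: dhomogD; [exact: (proj1 (hG j))|apply: dhomogZ].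
pose Q := \det c.
have hQ : Q \is (n.+1 * D).-homog by apply: det_form.
have Qs : Q.@[s 0] = 1.
  rewrite /Q -det_map_mx; apply: etrans (det1 _ _); congr (\det _).
  apply/matrixP => j k; rewrite [LHS]mxE cE /= mevalD mevalZ hs mulr1 !mxE.
  by rewrite addrC subrK.
have ceq x j : X x -> \sum_k (c j k).@[x 0] * (L k).@[x 0] =
    (linform h ^+ D).@[x 0] * ((v *m l j) 0 0 * (x *m tau) 0 0).
  move=> Xx; under eq_bigr => k _ do rewrite cE mevalD mevalZ mulrDl.
  rewrite big_split /=.
  have -> : \sum_k (G j k).@[x 0] * (L k).@[x 0] = 0.
    rewrite -[RHS](F'X j x Xx) (proj2 (hG j)) raddf_sum /=.
    by apply: eq_bigr => k _; rewrite mevalM mulrC.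
  rewrite add0r.
  have -> : (v *m l j) 0 0 * (x *m tau) 0 0 = (x *m l j) 0 0 - (x *m a j) 0 0.
    by rewrite aE; ring.
  rewrite -Gs mulrBr mulr_sumr.
  have -> : (x *m l j) 0 0 = \sum_k (j == k)%:R * (x *m l k) 0 0.
    rewrite (bigD1 j) //= eqxx mul1r big1 ?addr0 // => k kj.
    by rewrite eq_sym (negbTE kj) mul0r.
  rewrite mulr_sumr -sumrB; apply: eq_bigr => k _; rewrite LE; ring.
pose E k := \sum_j \adj c k j * ((v *m l j) 0 0 *: linform h ^+ D).
have hE k : E k \is (n.+1 * D).-homog.
  apply: rpred_sum => j _; rewrite mulSn addnC; apply: dhomogM; last exact: dhomogZ.
  rewrite mxE /cofactor -signr_odd mulr_sign.
  suff hd : \det (row' j (col' k c)) \is (n * D).-homog by case: ifP => _; rewrite ?rpredN.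
  by apply: det_form => i1 i2; rewrite 2!mxE; exact: hc.
have QL x k : X x -> Q.@[x 0] * (L k).@[x 0] = (x *m tau) 0 0 * (E k).@[x 0].
  move=> Xx.
  have adj i : \sum_j (\adj c k j).@[x 0] * (c j i).@[x 0] = Q.@[x 0] * (k == i)%:R.
    have := congr1 (fun M : 'M_n.+1 => (M k i).@[x 0]) (mul_adj_mx c).
    rewrite mxE raddf_sum /= => adjE.
    under eq_bigr => j _ do rewrite -mevalM.
    rewrite adjE mxE /Q; case: eqP => _; rewrite ?mulr1n ?mulr1 //.
    by rewrite mulr0n meval0 mulr0.
  have -> : Q.@[x 0] * (L k).@[x 0] =
      \sum_i (\sum_j (\adj c k j).@[x 0] * (c j i).@[x 0]) * (L i).@[x 0].
    under eq_bigr => i _ do rewrite adj.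
    rewrite (bigD1 k) //= eqxx mulr1 big1 ?addr0 // => i ik.
    by rewrite eq_sym (negbTE ik) mulr0 mul0r.
  under eq_bigr => i _ do rewrite mulr_suml.
  rewrite exchange_big /= /E raddf_sum /= mulr_sumr; apply: eq_bigr => j _.
  under eq_bigr => i _ do rewrite -mulrA.
  by rewrite -mulr_sumr ceq // mevalM mevalZ; ring.
clearbody Q.
exists v, tau, (n.+1 * D)%N, Q; split=> //; split=> //.
  by rewrite Qs oner_neq0.
move=> d H hH Hs; have [H' [hH' HE]] := form_taylor sh hH.
have {}HE : H = \sum_k L k * H' k by rewrite {1}HE Hs scale0r add0r.
have hEH : \sum_k E k * H' k \is (n.+1 * D + d).-homog.
  by apply: rpred_sum => k _; apply: dhomogM.
have EQ x : X x ->
    Q.@[x 0] * H.@[x 0] = (x *m tau) 0 0 * (\sum_k E k * H' k).@[x 0].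
  move=> Xx; rewrite {1}HE !raddf_sum /= !mulr_sumr; apply: eq_bigr => k _.
  by rewrite !mevalM mulrA QL // mulrA.
exists (\sum_k E k * H' k); split=> //.
have := tv (Q * H - linform tau * \sum_k E k * H' k) (n.+1 * D + d.+1)%N.
rewrite -/(dif _ s v) difB !difM Hs mulr0 add0r linformE st mul0r addr0.
rewrite dif_linform vt mul1r => tz; apply/eqP; rewrite eq_sym -subr_eq0; apply/eqP.
apply: tz; last by move=> x Xx; rewrite mevalB !mevalM linformE EQ // subrr.
apply: rpredB; first exact: dhomogM.
have -> : (n.+1 * D + d.+1 = 1 + (n.+1 * D + d))%N by lia.
by apply: dhomogM => //; exact: linform_form.
Qed.

End LocalParameter.

(** * Embeddings are immersions, and projection from a ruling *)

Section Ruling.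
Variable K : numClosedFieldType.
Implicit Types (n m d e : nat).

Definition represents n m (X : pset K n) (f : 'rV[K]_n.+1 -> 'rV[K]_m.+1) d
    (F : 'I_m.+1 -> {mpoly K[n.+1]}) : Prop :=
  (forall i, F i \is d.-homog) /\
  forall y, X y -> poly_map F y != 0 -> (f y == poly_map F y)%MS.

Definition dif_map n m (F : 'I_m.+1 -> {mpoly K[n.+1]}) (s v : 'rV[K]_n.+1) :
  'rV[K]_m.+1 := \row_i dif (F i) s v.

(** Multiplying with a coordinate makes the degree positive; in degree 0 the
division by a local parameter would produce forms of negative degree. *)
Lemma regular_represented n m (X : pset K n) (f : 'rV[K]_n.+1 -> 'rV[K]_m.+1) x :
  pclosed X -> regular X f -> X x ->
  exists d F, represents X f d.+1 F /\ poly_map F x != 0.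
Proof.
move=> cX rf Xx; have [d [F [hF Fx Ff]]] := rf x Xx.
have /rV0Pn[k xk] := pclosed_neq0 cX Xx.
have FE y : poly_map (fun i => 'X_k * F i) y = y 0 k *: poly_map F y.
  by apply/rowP => i; rewrite !mxE mevalM mevalXU.
exists d, (fun i => 'X_k * F i); split; last by rewrite FE scaler_eq0 negb_or xk.
split=> [i|y Xy]; first by rewrite -[d.+1]add1n; apply: dhomogM (var_form _ _) (hF i).
rewrite FE scaler_eq0 negb_or => /andP[yk Fy].
by apply: same_point_trans (Ff y Xy Fy) _; apply/same_point_sym/scale_same_point.
Qed.

Lemma same_point_minors n (x y : 'rV[K]_n) : x != 0 -> y != 0 ->
  (forall k l, x 0 k * y 0 l = x 0 l * y 0 k) -> (x == y)%MS.
Proof.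
move=> x0 /rV0Pn[l yl] xy.
have xE : x = (x 0 l / y 0 l) *: y.
  by apply/rowP => k; rewrite mxE mulrAC -xy mulfK.
have c0 : x 0 l / y 0 l != 0 by apply: contraNneq x0 => c0; rewrite xE c0 scale0r.
by have := scale_same_point y c0; rewrite -xE.
Qed.

Lemma difZr n (F : {mpoly K[n]}) x v c : dif F x (c *: v) = c * dif F x v.
Proof.
by rewrite /dif mulr_sumr; apply: eq_bigr => i _; rewrite mxE mulrCA.
Qed.

Lemma form_comp_val n m (F : 'I_m.+1 -> {mpoly K[n.+1]}) (G : {mpoly K[m.+1]})
    (x : 'rV[K]_n.+1) :
  (G \mPo [tuple F j | j < m.+1]).@[x 0] = G.@[poly_map F x 0].
Proof.
rewrite comp_mpoly_meval; apply: meval_eq => j.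
by rewrite tnth_mktuple mxE.
Qed.

(** Near s the inverse morphism is given by forms G, so that the composite of F
and G is a multiple of the identity on X up to forms vanishing on X.  If the
differential of F mapped v into the line of F(s), then by Euler's formula that of
the composite would map v into the line of s, and v would be proportional to s. *)
Lemma embedding_immersion n m (X : pset K n) (f : 'rV[K]_n.+1 -> 'rV[K]_m.+1)
    s v d F :
  pclosed X -> embedding X f -> X s -> tangent X s v -> (forall c, v <> c *: s) ->
  represents X f d F -> poly_map F s != 0 ->
  forall c, dif_map F s v <> c *: poly_map F s.
Proof.
move=> cX [cY [[rf fY] [g [[rg gX] gf fg]]]] Xs tv vs [hF Ff] p0 c wE.
set p := poly_map F s in p0 wE.
have Yf x : X x -> poly_map F x != 0 -> pimage X f (poly_map F x).
  by move=> Xx Fx; apply: (pclosed_same_point cY (Ff x Xx Fx)); apply: fY.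
have [e [G [hG Gp Gg]]] := rg p (Yf s Xs p0).
pose H i := G i \mPo [tuple F j | j < m.+1].
have hH i : H i \is (d * e).-homog by apply: form_comp.
have HE i (x : 'rV[K]_n.+1) : (H i).@[x 0] = (G i).@[poly_map F x 0] by exact: form_comp_val.
have /rV0Pn[k pk] := p0.
have Fk : (F k).@[s 0] != 0 by have := pk; rewrite mxE.
have Hx x : X x -> poly_map F x != 0 -> exists a, forall i, (H i).@[x 0] = a * x 0 i.
  move=> Xx Fx; case: (eqVneq (poly_map G (poly_map F x)) 0) => [G0|Gx].
    exists 0 => i; rewrite HE mul0r.
    by have := congr1 (fun u : 'rV_ _ => u 0 i) G0; rewrite !mxE.
  have : (poly_map G (poly_map F x) == x)%MS.
    apply: same_point_trans (same_point_sym (Gg _ (Yf x Xx Fx) Gx)) _.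
    apply: same_point_trans _ (gf x Xx).
    by apply: (regular_same_point cY rg (Yf x Xx Fx)); apply/same_point_sym/Ff.
  move=> /same_point_scale[a _ xE]; exists a => i.
  by rewrite HE; have := congr1 (fun u : 'rV_ _ => u 0 i) xE; rewrite !mxE.
have [a Ha] := Hx s Xs p0.
have a0 : a != 0.
  apply: contraNneq Gp => a0; apply/eqP/rowP => i.
  by rewrite mxE -HE Ha a0 mul0r mxE.
have dH i : dif (H i) s v = c * (e%:R * (a * s 0 i)).
  rewrite /H dif_comp.
  have -> : \row_i dif (F i) s v = c *: p by rewrite -wE.
  rewrite difZr (dif_euler p (hG i)).
  by rewrite -Ha HE.
have vE i j : s 0 i * v 0 j = s 0 j * v 0 i.
  (* Where F vanishes the inverse is not controlled; the factor F k takes care of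
     these points and is nonzero at s. *)
  pose M := (H i * 'X_j - H j * 'X_i) * F k.
  have hM : M \is (d * e + 1 + d).-homog.
    by apply: dhomogM => //; apply: rpredB; apply: dhomogM => //; exact: var_form.
  have MX x : X x -> M.@[x 0] = 0.
    move=> Xx; rewrite mevalM mevalB !mevalM !mevalXU.
    case: (eqVneq (poly_map F x) 0) => [F0|Fx].
      have := congr1 (fun u : 'rV_ _ => u 0 k) F0; rewrite !mxE => ->.
      by rewrite mulr0.
    by have [b Hb] := Hx x Xx Fx; rewrite !Hb; ring.
  have := tv M _ hM MX; rewrite -/(dif M s v) difM.
  rewrite mevalB !mevalM !mevalXU !Ha difB !difM !difXU !mevalXU !Ha !dH.
  move/eqP; rewrite mulrAC [X in _ + X](_ : _ = 0); last by ring.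
  rewrite addr0 mulf_eq0 (negbTE Fk) orbF.
  rewrite (_ : _ - _ = a * (s 0 i * v 0 j - s 0 j * v 0 i)); last by ring.
  by rewrite mulf_eq0 (negbTE a0) subr_eq0 => /eqP.
have /rV0Pn[i si] := pclosed_neq0 cX Xs.
apply: (vs (v 0 i / s 0 i)); apply/rowP => j; rewrite mxE.
by apply: (mulfI si); rewrite vE; field.
Qed.

Definition pencil n m (F : 'I_m.+1 -> {mpoly K[n.+1]}) (c : 'cV[K]_m.+1) :
  {mpoly K[n.+1]} := \sum_k c k 0 *: F k.

Lemma pencilE n m (F : 'I_m.+1 -> {mpoly K[n.+1]}) c (x : 'rV[K]_n.+1) :
  (pencil F c).@[x 0] = (poly_map F x *m c) 0 0.
Proof.
rewrite /pencil raddf_sum /= mxE; apply: eq_bigr => k _.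
by rewrite mevalZ mxE mulrC.
Qed.

Lemma dif_pencil n m (F : 'I_m.+1 -> {mpoly K[n.+1]}) c s v :
  dif (pencil F c) s v = (dif_map F s v *m c) 0 0.
Proof.
rewrite /pencil dif_sum mxE; apply: eq_bigr => k _.
by rewrite difZ mxE mulrC.
Qed.

Lemma pencil_form n m d (F : 'I_m.+1 -> {mpoly K[n.+1]}) c :
  (forall i, F i \is d.-homog) -> pencil F c \is d.-homog.
Proof. by move=> hF; apply: rpred_sum => k _; apply: dhomogZ. Qed.

Lemma poly_map_mul n m p (F : 'I_m.+1 -> {mpoly K[n.+1]}) (A : 'M[K]_(m.+1, p.+1)) y :
  poly_map (fun i => pencil F (col i A)) y = poly_map F y *m A.
Proof.
apply/rowP => i; rewrite mxE pencilE !mxE; apply: eq_bigr => k _.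
by rewrite [col _ _ _ _]mxE.
Qed.

Lemma dif_map_mul n m p (F : 'I_m.+1 -> {mpoly K[n.+1]}) (A : 'M[K]_(m.+1, p.+1)) s v :
  dif_map (fun i => pencil F (col i A)) s v = dif_map F s v *m A.
Proof.
apply/rowP => i; rewrite mxE dif_pencil !mxE; apply: eq_bigr => k _.
by rewrite [col _ _ _ _]mxE.
Qed.

Lemma represents_mul n m p (X : pset K n) (f : 'rV[K]_n.+1 -> 'rV[K]_m.+1) d F
    (A : 'M[K]_(m.+1, p.+1)) :
  represents X f d F ->
  represents X (fun x => f x *m A) d (fun i => pencil F (col i A)).
Proof.
move=> [hF fF]; split=> [i|y Xy]; first exact: pencil_form.
rewrite poly_map_mul.
case: (eqVneq (poly_map F y) 0) => [->|Fy _]; first by rewrite mul0mx eqxx.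
by apply: same_point_mul; apply: fF.
Qed.

Lemma represents_scale n m p (X : pset K n) (f : 'rV[K]_n.+1 -> 'rV[K]_m.+1) d F
    (A : 'M[K]_(m.+1, p.+1)) c : c != 0 ->
  represents X (fun x => f x *m (c *: A)) d F -> represents X (fun x => f x *m A) d F.
Proof.
move=> c0 [hF fF]; split=> // y Xy Fy.
apply: same_point_trans _ (fF y Xy Fy); apply: same_point_sym.
by rewrite -scalemxAr; exact: scale_same_point.
Qed.

Lemma regular_mul n m p (X : pset K n) (f : 'rV[K]_n.+1 -> 'rV[K]_m.+1)
    (A : 'M[K]_(m.+1, p.+1)) : row_free A -> regular X f -> regular X (fun x => f x *m A).
Proof.
move=> fA rf x Xx; have [d [F [hF Fx fF]]] := rf x Xx.
have [hFA fFA] := represents_mul A (conj hF fF).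
exists d, (fun i => pencil F (col i A)); split=> //.
rewrite poly_map_mul; apply: contraNneq Fx => h.
by rewrite -[poly_map F x]mulmx1 -(mulmxVp fA) mulmxA h mul0mx.
Qed.

(** Let a and b be coordinates of the pencil of planes through the line joining
j1(s) to j2(s).  The projections of j1 and j2 from that line never coincide away
from s, and at s they extend by the tangent directions w1 and w2, which differ.
The pair of projections thus maps X into the complement of the diagonal in the
product of two lines; this complement is affine and its coordinate functions
j1(b) j2(c) / (j1(a) j2(b) - j1(b) j2(a)), for c = a, b, are regular on all of X,
hence constant.  They vanish at s since w1(b) = 0. *)
Lemma projection_from_ruling n m (X : pset K n)
    (j1 j2 : 'rV[K]_n.+1 -> 'rV[K]_m.+1) s v tau e Q d1 d2 F1 F2
    (a b : 'cV[K]_m.+1) :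
  uncountable K -> pclosed X -> irreducible X -> X s -> local_param X s v tau e Q ->
  regular X j1 -> regular X j2 ->
  represents X j1 d1.+1 F1 -> represents X j2 d2.+1 F2 ->
  poly_map F1 s != 0 -> (forall c, c = a \/ c = b ->
    (poly_map F1 s *m c) 0 0 = 0 /\ (poly_map F2 s *m c) 0 0 = 0) ->
  (dif_map F1 s v *m a) 0 0 != 0 -> (dif_map F1 s v *m b) 0 0 = 0 ->
  (dif_map F2 s v *m b) 0 0 != 0 ->
  (forall x, X x -> ~~ (x == s)%MS ->
     (j1 x *m a) 0 0 * (j2 x *m b) 0 0 - (j1 x *m b) 0 0 * (j2 x *m a) 0 0 != 0) ->
  forall x, X x -> (j1 x *m b) 0 0 = 0.
Proof.
move=> uncK cX irX Xs [hQ Qs par] r1 r2 [hF1 rF1] [hF2 rF2] F1s ps w1a w1b w2b nondeg.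
have s0 := pclosed_neq0 cX Xs.
(* Linear forms vanishing at s: they serve as factors that erase s, and their
   divisibility by tau shows that tau has no zero besides s where Q is nonzero. *)
pose kap k l : {mpoly K[n.+1]} := s 0 l *: 'X_k - s 0 k *: 'X_l.
have hkap k l : kap k l \is 1.-homog.
  by apply: rpredB; apply: dhomogZ; exact: var_form.
have kapE k l (x : 'rV[K]_n.+1) : (kap k l).@[x 0] = s 0 l * x 0 k - s 0 k * x 0 l.
  by rewrite mevalB !mevalZ !mevalXU.
have kaps k l (x : 'rV[K]_n.+1) : (x == s)%MS -> (kap k l).@[x 0] = 0.
  by move=> /same_point_scale[c _ ->]; rewrite kapE !mxE; ring.
have kapN x : X x -> ~~ (x == s)%MS -> exists k l, (kap k l).@[x 0] != 0.
  move=> Xx; apply: contraNP => hn; apply: same_point_minors => //.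
    exact: pclosed_neq0 cX Xx.
  move=> k l; apply: contrapT => xkl; apply: hn; exists k, l.
  by rewrite kapE subr_eq0 mulrC [_ * x 0 l]mulrC; apply/eqP.
clearbody kap.
have tau0 x : X x -> ~~ (x == s)%MS -> (x *m tau) 0 0 = 0 -> Q.@[x 0] = 0.
  move=> Xx xs tx; have [k [l kx]] := kapN x Xx xs.
  have [E [_ _ QE]] := par 0%N _ (hkap k l) (kaps k l s (same_point_refl s)).
  have := QE x Xx; rewrite tx mul0r => /eqP; rewrite mulf_eq0 (negbTE kx) orbF.
  by move/eqP.
have parF d (F : 'I_m.+1 -> {mpoly K[n.+1]}) (c : 'cV[K]_m.+1) :
    (forall i, F i \is d.+1.-homog) ->
    (poly_map F s *m c) 0 0 = 0 -> exists E,
    [/\ E \is (e + d).-homog, E.@[s 0] = Q.@[s 0] * (dif_map F s v *m c) 0 0 &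
      forall x, X x ->
        Q.@[x 0] * (poly_map F x *m c) 0 0 = (x *m tau) 0 0 * E.@[x 0]].
  move=> hF Fs; have [|E [hE Es EX]] := par d _ (pencil_form c hF).
    by rewrite pencilE.
  exists E; split=> //; first by rewrite Es dif_pencil.
  by move=> x Xx; rewrite -EX // pencilE.
have [ps1a ps2a] := ps a (or_introl erefl).
have [ps1b ps2b] := ps b (or_intror erefl).
have [E1a [hE1a E1as E1aX]] := parF _ F1 a hF1 ps1a.
have [E1b [hE1b E1bs E1bX]] := parF _ F1 b hF1 ps1b.
have [E2a [hE2a E2as E2aX]] := parF _ F2 a hF2 ps2a.
have [E2b [hE2b E2bs E2bX]] := parF _ F2 b hF2 ps2b.
rewrite w1b mulr0 in E1bs.
have mz (h : 'cV[K]_m.+1) : ((0 : 'rV[K]_m.+1) *m h) 0 0 = 0 by rewrite mul0mx mxE.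
pose G x := (j1 x *m a) 0 0 * (j2 x *m b) 0 0 - (j1 x *m b) 0 0 * (j2 x *m a) 0 0.
have prod0 c : c = a \/ c = b -> forall x, X x -> ~~ (x == s)%MS ->
    (j1 x *m b) 0 0 * (j2 x *m c) 0 0 = 0.
  move=> cab; have [ps1c ps2c] := ps c cab.
  have [E2c [hE2c E2cs E2cX]] := parF _ F2 c hF2 ps2c.
  (* The value 0 at s is the limit: there the numerator is a product of quotients
     by tau, the first of which vanishes at s because w1 is in the plane b = 0. *)
  pose f x := if (x == s)%MS then 0 else (j1 x *m b) 0 0 * (j2 x *m c) 0 0 / G x.
  have scaled (F F' : 'I_m.+1 -> {mpoly K[n.+1]}) y : X y -> ~~ (y == s)%MS ->
      (j1 y == poly_map F y)%MS -> (j2 y == poly_map F' y)%MS ->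
      (poly_map F y *m a) 0 0 * (poly_map F' y *m b) 0 0 -
        (poly_map F y *m b) 0 0 * (poly_map F' y *m a) 0 0 != 0 /\
      f y = (poly_map F y *m b) 0 0 * (poly_map F' y *m c) 0 0 /
        ((poly_map F y *m a) 0 0 * (poly_map F' y *m b) 0 0 -
          (poly_map F y *m b) 0 0 * (poly_map F' y *m a) 0 0).
    move=> Xy ys /same_point_scale[al al0 j1E] /same_point_scale[be be0 j2E].
    have sc (u : 'rV[K]_m.+1) (h : 'cV[K]_m.+1) x : (x *: u *m h) 0 0 = x * (u *m h) 0 0.
      by rewrite -scalemxAl mxE.
    have := nondeg y Xy ys; rewrite /f (negbTE ys) /G j1E j2E !sc.
    move: ((poly_map F y *m a) 0 0) ((poly_map F y *m b) 0 0).
    move: ((poly_map F' y *m a) 0 0) ((poly_map F' y *m b) 0 0).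
    move: ((poly_map F' y *m c) 0 0) => B3 B1 B2 A1 A2 h.
    have Gy : A1 * B2 - A2 * B1 != 0.
      apply: contraNneq (h) => h0.
      have -> : al * A1 * (be * B2) - al * A2 * (be * B1) =
        al * be * (A1 * B2 - A2 * B1) by ring.
      by rewrite h0 mulr0.
    by split=> //; field; rewrite Gy h.
  have [] : exists z, forall x, X x -> f x = z.
    apply: (regular_function_const uncK cX irX) => x Xx.
    case: (boolP (x == s)%MS) => xs.
      exists (e + (e + d1 + (e + d2)))%N, (Q * (E1b * E2c)), (Q * (E1a * E2b - E1b * E2a)).
      split.
      - by apply: dhomogM => //; exact: dhomogM.
      - by apply: dhomogM => //; apply: rpredB; exact: dhomogM.
      - apply/eqP => Qx.
        have hH := dhomogM hQ (rpredB (dhomogM hE1a hE2b) (dhomogM hE1b hE2a)).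
        have := form_same_point hH xs Qx.
        rewrite mevalM mevalB !mevalM E1as E2bs E1bs mul0r subr0.
        by apply/eqP; rewrite !mulf_neq0.
      move=> y Xy; case: (boolP (y == s)%MS) => ys.
        rewrite /f ys mul0r; apply/esym.
        apply: (form_same_point (dhomogM hQ (dhomogM hE1b hE2c)) (same_point_sym ys)).
        by rewrite !mevalM E1bs mul0r mulr0.
      rewrite !mevalM mevalB !mevalM.
      case: (eqVneq Q.@[y 0] 0) => [->|Qy]; first by rewrite !mul0r mulr0.
      case: (eqVneq ((y *m tau) 0 0) 0) => [ty|ty].
        by rewrite (tau0 y Xy ys ty) eqxx in Qy.
      have div F E : Q.@[y 0] * F = (y *m tau) 0 0 * E -> E = Q.@[y 0] * F / (y *m tau) 0 0.
        by move=> ->; rewrite mulrAC mulfV // mul1r.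
      rewrite (div _ _ (E1aX y Xy)) (div _ _ (E1bX y Xy)) (div _ _ (E2aX y Xy)).
      rewrite (div _ _ (E2bX y Xy)) (div _ _ (E2cX y Xy)).
      case: (eqVneq (poly_map F1 y) 0) => [->|F1y].
        by rewrite !mz; ring.
      case: (eqVneq (poly_map F2 y) 0) => [->|F2y].
        by rewrite !mz; ring.
      have [] := scaled F1 F2 y Xy ys (rF1 y Xy F1y) (rF2 y Xy F2y).
      move: ((poly_map F2 y *m c) 0 0) => B3.
      move: ((poly_map F1 y *m a) 0 0) ((poly_map F1 y *m b) 0 0).
      move: ((poly_map F2 y *m a) 0 0) ((poly_map F2 y *m b) 0 0) => B1 B2 A1 A2 Gy ->.
      by field; rewrite Gy ty.
    have [d [F [hF Fx jF]]] := r1 x Xx.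
    have [d' [F' [hF' Fx' jF']]] := r2 x Xx.
    have [k [l kx]] := kapN x Xx xs.
    exists (1 + (d + d'))%N, (kap k l * (pencil F b * pencil F' c)),
      (kap k l * (pencil F a * pencil F' b - pencil F b * pencil F' a)).
    split.
    - by apply: dhomogM => //; apply: dhomogM; exact: pencil_form.
    - by apply: dhomogM => //; apply: rpredB; apply: dhomogM; exact: pencil_form.
    - have [Gx _] := scaled F F' x Xx xs (jF x Xx Fx) (jF' x Xx Fx').
      by rewrite mevalM mevalB !mevalM !pencilE mulf_neq0.
    move=> y Xy; rewrite !mevalM mevalB !mevalM.
    case: (boolP (y == s)%MS) => ys; first by rewrite kaps // !mul0r mulr0.
    rewrite !pencilE; case: (eqVneq (poly_map F y) 0) => [->|Fy].
      by rewrite !mz; ring.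
    case: (eqVneq (poly_map F' y) 0) => [->|Fy'].
      by rewrite !mz; ring.
    have [] := scaled F F' y Xy ys (jF y Xy Fy) (jF' y Xy Fy').
    move: ((poly_map F' y *m c) 0 0) => B3.
    move: ((poly_map F y *m a) 0 0) ((poly_map F y *m b) 0 0).
    move: ((poly_map F' y *m a) 0 0) ((poly_map F' y *m b) 0 0) => B1 B2 A1 A2 Gy ->.
    by field; rewrite Gy.
  move=> z fz x Xx xs.
  have z0 : z = 0 by rewrite -(fz s Xs) /f submx_refl.
  have := fz x Xx; rewrite /f (negbTE xs) z0 => /eqP.
  by rewrite mulf_eq0 invr_eq0 (negbTE (nondeg x Xx xs)) orbF => /eqP.
move=> x Xx; case: (boolP (x == s)%MS) => xs.
  have : (j1 x == poly_map F1 s)%MS.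
    apply: same_point_trans (regular_same_point cX r1 Xx xs) _.
    exact: rF1.
  by move=> /same_point_scale[c _ ->]; rewrite -scalemxAl mxE ps1b mulr0.
have := prod0 a (or_introl erefl) x Xx xs.
have := prod0 b (or_intror erefl) x Xx xs.
move=> /eqP; rewrite mulf_eq0 => /orP[/eqP//|/eqP j2b].
move=> /eqP; rewrite mulf_eq0 => /orP[/eqP//|/eqP j2a].
by have := nondeg x Xx xs; rewrite j2a j2b !mulr0 subrr eqxx.
Qed.

End Ruling.

(** * Generic pairs of matrices *)

Section Generic.
Variable K : numClosedFieldType.
Implicit Types (n m d e : nat).

Definition polyfun m (f : 'M[K]_m -> 'M[K]_m -> K) : Prop :=
  exists F : {mpoly K[m * m + m * m]},
    forall g h, f g h = F.@[row_mx (mxvec g) (mxvec h) 0].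

Lemma polyfun_const m c : polyfun (fun _ _ : 'M[K]_m => c).
Proof. by exists c%:MP => g h; rewrite mevalC. Qed.

Lemma polyfunD m (f1 f2 : 'M[K]_m -> 'M[K]_m -> K) :
  polyfun f1 -> polyfun f2 -> polyfun (fun g h => f1 g h + f2 g h).
Proof.
by move=> [F1 F1E] [F2 F2E]; exists (F1 + F2) => g h; rewrite mevalD F1E F2E.
Qed.

Lemma polyfunM m (f1 f2 : 'M[K]_m -> 'M[K]_m -> K) :
  polyfun f1 -> polyfun f2 -> polyfun (fun g h => f1 g h * f2 g h).
Proof.
by move=> [F1 F1E] [F2 F2E]; exists (F1 * F2) => g h; rewrite mevalM F1E F2E.
Qed.

Lemma polyfunB m (f1 f2 : 'M[K]_m -> 'M[K]_m -> K) :
  polyfun f1 -> polyfun f2 -> polyfun (fun g h => f1 g h - f2 g h).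
Proof.
by move=> [F1 F1E] [F2 F2E]; exists (F1 - F2) => g h; rewrite mevalB F1E F2E.
Qed.

Lemma polyfun_sum m (I : Type) (r : seq I) (P : pred I)
    (f : I -> 'M[K]_m -> 'M[K]_m -> K) :
  (forall i, polyfun (f i)) -> polyfun (fun g h => \sum_(i <- r | P i) f i g h).
Proof.
move=> /choice[F FE]; exists (\sum_(i <- r | P i) F i) => g h.
by rewrite raddf_sum /=; apply: eq_bigr => i _.
Qed.

Lemma polyfun_left m i j : polyfun (fun g _ : 'M[K]_m => g i j).
Proof.
exists 'X_(lshift (m * m) (mxvec_index i j)) => g h.
by rewrite mevalXU row_mxEl mxvecE.
Qed.

Lemma polyfun_right m i j : polyfun (fun _ h : 'M[K]_m => h i j).
Proof.
exists 'X_(rshift (m * m) (mxvec_index i j)) => g h.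
by rewrite mevalXU row_mxEr mxvecE.
Qed.

Lemma polyfun_det m N (A : 'M[K]_m -> 'M[K]_m -> 'M[K]_N) :
  (forall i j, polyfun (fun g h => A g h i j)) -> polyfun (fun g h => \det (A g h)).
Proof.
move=> hA; have /choice[F FE] := fun ij : 'I_N * 'I_N => hA ij.1 ij.2.
exists (\det (\matrix_(i, j) F (i, j))) => g h.
rewrite -det_map_mx; congr (\det _); apply/matrixP => i j.
by rewrite !mxE (FE (i, j)).
Qed.

Lemma polyfun_swap m (f : 'M[K]_m -> 'M[K]_m -> K) :
  polyfun f -> polyfun (fun g h => f h g).
Proof.
move=> [F FE].
pose sw (i : 'I_(m * m + m * m)) : 'I_(m * m + m * m) :=
  match split i with inl j => rshift _ j | inr j => lshift _ j end.
exists (F \mPo [tuple 'X_(sw i) | i < _]) => g h.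
rewrite FE comp_mpoly_meval; apply: meval_eq => i.
rewrite tnth_mktuple mevalXU /sw.
by rewrite -(splitK i); case: (split i) => j;
  rewrite unsplitK /= ?row_mxEl ?row_mxEr.
Qed.

Lemma polyfun_rowl m (u : 'rV[K]_m) j : polyfun (fun g _ : 'M[K]_m => (u *m g) 0 j).
Proof.
have [A AE] : polyfun (fun g _ : 'M[K]_m => \sum_k u 0 k * g k j).
  apply: polyfun_sum => k; apply: polyfunM; [exact: polyfun_const|exact: polyfun_left].
by exists A => g h; rewrite mxE (AE g h).
Qed.

Lemma polyfun_rowr m (u : 'rV[K]_m) j : polyfun (fun _ h : 'M[K]_m => (u *m h) 0 j).
Proof. exact: polyfun_swap (polyfun_rowl u j). Qed.

Lemma polyfun_scale m (a b : K) (f : 'M[K]_m -> 'M[K]_m -> K) :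
  polyfun f -> polyfun (fun g h => f (a *: g) (b *: h)).
Proof.
move=> [F FE].
pose sc (i : 'I_(m * m + m * m)) : {mpoly K[m * m + m * m]} :=
  (if (i < m * m)%N then a else b) *: 'X_i.
exists (F \mPo [tuple sc i | i < _]) => g h.
rewrite FE comp_mpoly_meval; apply: meval_eq => i.
rewrite tnth_mktuple /sc mevalZ mevalXU !linearZ /=.
by case: (split_ordP i) => j ->; rewrite ?row_mxEl ?row_mxEr mxE.
Qed.

(** Polynomials form a domain, so nonempty open sets of pairs intersect. *)
Lemma polyfun_common_nonzero m (f1 f2 : 'M[K]_m -> 'M[K]_m -> K) :
  polyfun f1 -> polyfun f2 -> (exists g h, f1 g h != 0) ->
  (exists g h, f2 g h != 0) -> exists g h, f1 g h * f2 g h != 0.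
Proof.
move=> [F1 F1E] [F2 F2E] [g1 [h1 f1n]] [g2 [h2 f2n]].
have F0 (F : {mpoly K[m * m + m * m]}) (x : 'I_(m * m + m * m) -> K) :
    F.@[x] != 0 -> F != 0.
  by apply: contraNneq => ->; rewrite meval0.
rewrite F1E in f1n; rewrite F2E in f2n.
have [x] := mpoly_neq0_val (mulf_neq0 (F0 _ _ f1n) (F0 _ _ f2n)).
rewrite mevalM => xn; pose y := \row_i x i.
exists (vec_mx (lsubmx y)), (vec_mx (rsubmx y)).
rewrite F1E F2E !vec_mxK hsubmxK.
have yE F : F.@[y 0] = F.@[x] by apply: meval_eq => i; rewrite mxE.
by rewrite !yE.
Qed.

Lemma polyfun_det_left m : polyfun (fun g _ : 'M[K]_m => \det g).
Proof. by apply: polyfun_det => i j; apply: polyfun_left. Qed.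

Lemma polyfun_det_right m : polyfun (fun _ h : 'M[K]_m => \det h).
Proof. by apply: polyfun_det => i j; apply: polyfun_right. Qed.

(** The open set is where some rescaling of P is nonzero; the rescalings make it
invariant, as P itself need not be homogeneous. *)
Lemma generically_polyfun m (P : 'M[K]_m -> 'M[K]_m -> K)
    (Q : 'M[K]_m -> 'M[K]_m -> Prop) :
  polyfun P -> (exists g h, P g h != 0) ->
  (forall a b g h, a != 0 -> b != 0 -> g \in unitmx -> h \in unitmx ->
     P (a *: g) (b *: h) != 0 -> Q g h) ->
  generically Q.
Proof.
move=> pP Pn PQ.
exists (fun g h => [/\ g \in unitmx, h \in unitmx &
  exists a b, [/\ a != 0, b != 0 & P (a *: g) (b *: h) != 0]]); split.
- split=> [g h [//]|a b g h a0 b0 [ug uh [a' [b' [a'0 b'0 Pgh]]]]|].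
    split; [by rewrite unitmxZ ?unitfE|by rewrite unitmxZ ?unitfE|].
    exists (a' / a), (b' / b); rewrite !scalerA !divfK //; split=> //.
      by rewrite mulf_neq0 ?invr_eq0.
    by rewrite mulf_neq0 ?invr_eq0.
  exists (fun F => exists a b, [/\ a != 0, b != 0 &
    forall g h, P (a *: g) (b *: h) = F.@[row_mx (mxvec g) (mxvec h) 0]]).
  move=> g h ug uh; split=> [[_ _ [a [b [a0 b0 Pgh]]]]|[F [[a [b [a0 b0 PE]]] Fgh]]].
    have [F FE] := polyfun_scale a b pP; exists F; split; last by rewrite -FE.
    by exists a, b.
  by split=> //; exists a, b; split=> //; rewrite PE.
- move=> V [Vu _ [S SE]] [g0 [h0 Vgh]].
  have [ug0 uh0] := Vu _ _ Vgh; have [F [SF Fgh]] := (SE _ _ ug0 uh0).1 Vgh.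
  pose f g h := F.@[row_mx (mxvec g) (mxvec h) 0].
  have pf : polyfun f by exists F.
  have pd := polyfunM (polyfun_det_left m) (polyfun_det_right m).
  have [g [h]] : exists g h, P g h * (f g h * (\det g * \det h)) != 0.
    apply: polyfun_common_nonzero => //; first exact: polyfunM.
    exists g0, h0; rewrite mulf_neq0 // mulf_neq0 // -unitfE; exact: ug0 || exact: uh0.
  rewrite !mulf_eq0 !negb_or => /andP[Pgh /andP[fgh /andP[dg dh]]].
  have ug : g \in unitmx by rewrite unitmxE unitfE.
  have uh : h \in unitmx by rewrite unitmxE unitfE.
  exists g, h; split; last by apply/(SE _ _ ug uh); exists F.
  by split=> //; exists 1, 1; rewrite !scale1r oner_neq0.
- by move=> g h [ug uh [a [b [a0 b0 Pgh]]]]; apply: PQ Pgh.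
Qed.

Definition minor2 m (u w : 'rV[K]_m) k l : K := u 0 k * w 0 l - u 0 l * w 0 k.

Lemma minor2_scale m (a b : K) (u w : 'rV[K]_m) k l :
  minor2 (a *: u) (b *: w) k l = a * b * minor2 u w k l.
Proof. by rewrite /minor2 !mxE; ring. Qed.

Lemma minor2C m (u w : 'rV[K]_m) k l : minor2 u w k l = - minor2 w u k l.
Proof. by rewrite /minor2; ring. Qed.

(** Apply the graded Nullstellensatz to the forms which deform, polynomially in
(g, h), into forms vanishing at all points of X where j1 g and j2 h coincide.  At
(g0, h0) they have no common zero, so all monomials of some degree N deform in
this way.  The determinant of the deformed monomials, expressed in the original
ones, is the required polynomial: it is 1 at (g0, h0), and where it is nonzero a
point of coincidence would annihilate all monomials. *)
Lemma disjointness_open n m (X : pset K n) (j1 j2 : 'rV[K]_n.+1 -> 'rV[K]_m.+1)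
    (g0 h0 : 'M[K]_m.+1) :
  uncountable K -> pclosed X -> regular X j1 -> regular X j2 ->
  (forall x, X x -> exists k l, minor2 (j1 x *m g0) (j2 x *m h0) k l != 0) ->
  exists P, [/\ polyfun P, P g0 h0 != 0 &
    forall g h, P g h != 0 -> forall x, X x ->
      exists k l, minor2 (j1 x *m g) (j2 x *m h) k l != 0].
Proof.
move=> uncK cX r1 r2 disj0.
pose coinc (g h : 'M[K]_m.+1) x := forall k l, minor2 (j1 x *m g) (j2 x *m h) k l = 0.
pose J d (f : {mpoly K[n.+1]}) := f \is d.-homog /\ exists phi,
  [/\ forall g h, phi g h \is d.-homog,
      forall mon, polyfun (fun g h : 'M[K]_m.+1 => (phi g h)@_mon), phi g0 h0 = f &
      forall g h x, X x -> coinc g h x -> (phi g h).@[x 0] = 0].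
have J_const d f : f \is d.-homog -> (forall x, X x -> f.@[x 0] = 0) -> J d f.
  move=> hf fX; split=> //; exists (fun _ _ => f); split=> //.
    by move=> mon; exact: polyfun_const.
  by move=> g h x Xx _; exact: fX.
have gJ : graded_ideal J.
  split.
  - by move=> d F [].
  - by move=> d; apply: J_const; [exact: dhomog0|move=> x _; rewrite meval0].
  - move=> d F G [hF [p [hp pp p0 pX]]] [hG [q [hq pq q0 qX]]].
    split; first exact: dhomogD.
    exists (fun g h => p g h + q g h); split.
    + by move=> g h; apply: dhomogD.
    + move=> mon; have [A AE] := polyfunD (pp mon) (pq mon).
      by exists A => g h; rewrite mcoeffD AE.
    + by rewrite p0 q0.
    + by move=> g h x Xx cx; rewrite mevalD (pX _ _ _ Xx cx) (qX _ _ _ Xx cx) addr0.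
  - move=> d e F G hF [hG [q [hq pq q0 qX]]].
    split; first exact: dhomogM.
    exists (fun g h => F * q g h); split.
    + by move=> g h; apply: dhomogM.
    + move=> mon.
      pose B := 'X_{1..n.+1 < (mdeg mon).+1, (mdeg mon).+1}.
      have [A AE] := polyfun_sum (index_enum (B : finType))
        (fun k : B => mon == (k.1 + k.2)%MM)
        (fun k : B => polyfunM (@polyfun_const m.+1 F@_(k.1)) (pq k.2)).
      by exists A => g h; rewrite mcoeffM -AE.
    + by rewrite q0.
    + by move=> g h x Xx cx; rewrite mevalM (qX _ _ _ Xx cx) mulr0.
have [|N hN] := graded_nullstellensatz uncK gJ.
  move=> a a0; case: (pselect (X a)) => Xa; last first.
    have [d [F [hF FX Fa]]] := pclosed_separate cX a0 Xa.
    by exists d, F; split=> //; apply: J_const.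
  have [d [F [hF Fa jF]]] := r1 a Xa; have [d' [F' [hF' Fa' jF']]] := r2 a Xa.
  have [k [l kl]] := disj0 a Xa.
  pose phi (g h : 'M[K]_m.+1) := pencil F (col k g) * pencil F' (col l h) -
    pencil F (col l g) * pencil F' (col k h).
  have phiE g h (x : 'rV[K]_n.+1) :
      (phi g h).@[x 0] = minor2 (poly_map F x *m g) (poly_map F' x *m h) k l.
    have ce (u : 'rV[K]_m.+1) (A : 'M[K]_m.+1) i : (u *m col i A) 0 0 = (u *m A) 0 i.
      by rewrite !mxE; apply: eq_bigr => p _; rewrite [col _ _ _ _]mxE.
    by rewrite /minor2 mevalB !mevalM !pencilE !ce.
  have hphi g h : phi g h \is (d + d').-homog.
    by apply: rpredB; apply: dhomogM; apply: pencil_form.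
  exists (d + d')%N, (phi g0 h0); split; last first.
    rewrite phiE; apply: contraNneq kl => h0'.
    have /same_point_scale[al _ ->] := jF a Xa Fa.
    have /same_point_scale[be _ ->] := jF' a Xa Fa'.
    by rewrite -!scalemxAl minor2_scale h0' mulr0.
  split=> //; exists phi; split=> //; last first.
    move=> g h x Xx cx; rewrite phiE.
    case: (eqVneq (poly_map F x) 0) => [->|Fx].
      by rewrite mul0mx /minor2 !mxE !mul0r subrr.
    case: (eqVneq (poly_map F' x) 0) => [->|Fx'].
      by rewrite mul0mx /minor2 !mxE !mulr0 subrr.
    have /same_point_sym/same_point_scale[al _ ->] := jF x Xx Fx.
    have /same_point_sym/same_point_scale[be _ ->] := jF' x Xx Fx'.
    by rewrite -!scalemxAl minor2_scale cx mulr0.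
  have term (c1 c2 : 'M[K]_m.+1 -> 'M[K]_m.+1 -> 'cV[K]_m.+1) mon :
      (forall p, polyfun (fun g h => c1 g h p 0)) ->
      (forall p, polyfun (fun g h => c2 g h p 0)) ->
      polyfun (fun g h => (pencil F (c1 g h) * pencil F' (c2 g h))@_mon).
    move=> p1 p2.
    have -> : (fun g h => (pencil F (c1 g h) * pencil F' (c2 g h))@_mon) =
        (fun g h => \sum_p \sum_q c1 g h p 0 * (c2 g h q 0 * (F p * F' q)@_mon)).
      apply/funext => g; apply/funext => h.
      rewrite /pencil mulr_suml raddf_sum /=; apply: eq_bigr => p _.
      rewrite mulr_sumr raddf_sum /=; apply: eq_bigr => q _.
      by rewrite -scalerAl -scalerAr !mcoeffZ.
    apply: polyfun_sum => p; apply: polyfun_sum => q.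
    by apply: (polyfunM (p1 p)); apply: (polyfunM (p2 q)); exact: polyfun_const.
  move=> mon; have -> : (fun g h => (phi g h)@_mon) = (fun g h =>
    (pencil F (col k g) * pencil F' (col l h))@_mon -
    (pencil F (col l g) * pencil F' (col k h))@_mon).
    by apply/funext => g; apply/funext => h; rewrite mcoeffB.
  have pl i p : polyfun (fun g _ : 'M[K]_m.+1 => col i g p 0).
    by have [A AE] := polyfun_left p i; exists A => g h; rewrite mxE (AE g h).
  have pr i p : polyfun (fun _ h : 'M[K]_m.+1 => col i h p 0).
    by have [A AE] := polyfun_right p i; exists A => g h; rewrite mxE (AE g h).
  by apply: polyfunB; apply: term => p; [exact: pl|exact: pr|exact: pl|exact: pr].
have hN' (mon : 'X_{1..n.+1}) : exists phi, mdeg mon = N ->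
  [/\ forall g h, phi g h \is N.-homog,
      forall mon', polyfun (fun g h : 'M[K]_m.+1 => (phi g h)@_mon'),
      phi g0 h0 = 'X_[mon] &
      forall g h x, X x -> coinc g h x -> (phi g h).@[x 0] = 0].
  case: (eqVneq (mdeg mon) N) => [md|/eqP md]; last by exists (fun _ _ => 0).
  by have [_ [phi hphi]] := hN mon md; exists phi.
have [phi hphi] := choice hN'.
pose B := #|{: 'X_{1..n.+1 < N.+1}}|.
pose c g h := \matrix_(i < B, j < B)
  if mdeg (degree_mon j) == N then (phi (degree_mon j) g h)@_(degree_mon i)
  else (i == j)%:R.
exists (fun g h => \det (c g h)); split.
- apply: polyfun_det => i j.
  case: (eqVneq (mdeg (degree_mon j)) N) => mj.
    have [_ /(_ (degree_mon i))[A AE] _ _] := hphi _ mj.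
    by exists A => g h; rewrite mxE mj eqxx AE.
  by exists (i == j)%:R%:MP => g h; rewrite mxE (negbTE mj) mevalC.
- suff -> : c g0 h0 = 1%:M by rewrite det1 oner_neq0.
  apply/matrixP => i j; rewrite !mxE; case: eqP => // mj.
  have [_ _ -> _] := hphi _ mj.
  by rewrite mcoeffX (inj_eq (@degree_mon_inj _ _)) eq_sym.
- move=> g h cgh x Xx; apply: contrapT => hn.
  have cx : coinc g h x.
    by move=> k l; apply: contrapT => /eqP kl; apply: hn; exists k, l.
  have /eqP := monomial_row_neq0 N (pclosed_neq0 cX Xx); apply.
  have uc : c g h \in unitmx by rewrite unitmxE unitfE.
  rewrite -[LHS](mulmxK uc) (_ : _ *m c g h = 0) ?mul0mx //.
  apply/rowP => j; rewrite mxE [RHS]mxE; case: (eqVneq (mdeg (degree_mon j)) N) => mj.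
    have [hp _ _ pX] := hphi _ mj.
    rewrite -[RHS](pX g h x Xx cx) (form_monomial_row _ (hp g h)).
    by apply: eq_bigr => i _; rewrite [c _ _ _ _]mxE mj eqxx.
  rewrite (bigD1 j) //= big1 => [|i ij].
    by rewrite addr0 mxE (negbTE mj) mul0r.
  by rewrite [c _ _ _ _]mxE (negbTE mj) (negbTE ij) mulr0.
Qed.

End Generic.

(** * Lines as embedded curves *)

Section Lines.
Variable K : numClosedFieldType.
Implicit Types (n m d e : nat).

Lemma pclosed_ext n (X Y : pset K n) : (forall x, X x <-> Y x) -> pclosed X -> pclosed Y.
Proof. by move=> XY; have -> : Y = X by apply/predeqP => x; split=> /XY. Qed.

(** A curve with finite hyperplane sections misses the line cut out by one such
hyperplane and another one avoiding the finitely many points of the section. *)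
Lemma curve_misses_line n (Y : pset K n) d : (forall y, Y y -> y != 0) ->
  curve_degree Y d ->
  exists a b : 'cV[K]_n.+1, forall y, Y y -> ((y *m a) 0 0 != 0) || ((y *m b) 0 0 != 0).
Proof.
move=> Y0 [U [_ dU secU]].
have [||h [Uh _]] := dU (@pspace K n).
- split=> //; apply: pclosed_ext (@pclosed0 K n) => x; split=> // -[x0 []].
  exact: x0.
- exists (const_mx 1); apply/rV0Pn; exists ord0; rewrite mxE; exact: oner_neq0.
have [p [Yp _ pcov]] := secU h Uh.
have [t tp] : exists t, (\prod_i rVpoly (p i)).[t] != 0.
  apply: exists_nonroot; apply/prodf_neq0 => i _.
  have [/Y0 + _] := Yp i; apply: contraNneq => r0.
  by rewrite -(rVpolyK (p i)) r0 linear0.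
exists h^T, (\col_k t ^+ k) => y Yy; rewrite -negb_and; apply/negP => /andP[/eqP yh yt].
have [|i /same_point_scale[c c0 yE]] := pcov y.
  by split=> //; apply/matrixP => i j; rewrite !ord1 yh mxE.
move: tp; rewrite horner_prod => /prodf_neq0/(_ i isT)/negP; apply.
have -> : (rVpoly (p i)).[t] = (p i *m \col_k t ^+ k) 0 0.
  rewrite /rVpoly horner_poly mxE; apply: eq_bigr => k _.
  by rewrite insubT // => kn; rewrite mxE; congr (p i _ _ * _); apply: val_inj.
by move: yt; rewrite yE -scalemxAl mxE mulf_eq0 (negbTE c0).
Qed.

(** Near a point x where f is given by forms F, the fiber is cut out by the forms
c_l F_k - c_k F_l. *)
Lemma fiber_closed n m (X : pset K n) (f : 'rV[K]_n.+1 -> 'rV[K]_m.+1)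
    (c : 'rV[K]_m.+1) :
  pclosed X -> regular X f -> c != 0 -> pclosed (fun x => X x /\ (f x == c)%MS).
Proof.
move=> cX rf c0; apply: pclosed_intro => [x [/(pclosed_neq0 cX)]//|x x0 Xfx].
case: (pselect (X x)) => Xx; last first.
  have [d [F [hF FX Fx]]] := pclosed_separate cX x0 Xx.
  by exists d, F; split=> // y [/FX].
have [d [F [hF Fx fF]]] := rf x Xx.
have [k [l kl]] : exists k l, minor2 (poly_map F x) c k l != 0.
  apply: contrapT => hn; apply: Xfx; split=> //.
  apply: same_point_trans (fF x Xx Fx) _; apply: same_point_minors => // k l.
  apply: contrapT => kl; apply: hn; exists k, l.
  by rewrite /minor2 subr_eq0; apply/eqP.
have val (y : 'rV[K]_n.+1) :
    (c 0 l *: F k - c 0 k *: F l).@[y 0] = minor2 (poly_map F y) c k l.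
  by rewrite mevalB !mevalZ /minor2 !mxE; ring.
exists d, (c 0 l *: F k - c 0 k *: F l); split; last by rewrite val.
  by apply: rpredB; apply: dhomogZ.
move=> y [Xy fy]; rewrite val; case: (eqVneq (poly_map F y) 0) => [->|Fy].
  by rewrite /minor2 !mxE !mul0r subrr.
have /same_point_scale[a _ ->] := same_point_trans (same_point_sym (fF y Xy Fy)) fy.
by rewrite /minor2 !mxE; ring.
Qed.

(** A proper closed subset of a line is finite, and an irreducible finite set is
a point; but X, which contains a chain of two closed irreducible sets, is not. *)
Lemma embedding_onto_line n m (X : pset K n) (f : 'rV[K]_n.+1 -> 'rV[K]_m.+1)
    (L : 'M[K]_(2, m.+1)) :
  pclosed X -> irreducible X -> closed_chain X 1 -> embedding X f -> row_free L ->
  (forall x, X x -> (f x <= L)%MS) ->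
  forall y, y != 0 -> (y <= L)%MS -> pimage X f y.
Proof.
move=> cX irX [Z [hZ sZ]] [cY [[rf fY] [g [[rg gX] gf _]]]] fL fXL y y0 yL.
apply: contrapT => Yy.
have [d [F [hF FY Fy]]] := pclosed_separate cY y0 Yy.
have [z [_ _ hz]] := line_complement fL y0 yL.
pose r := along F (fun i => (y 0 i)%:P + z 0 i *: 'X).
have rE u : r.[u] = F.@[(y + u *: z) 0].
  rewrite horner_along; apply: meval_eq => i.
  by rewrite hornerD hornerC hornerZ hornerX !mxE mulrC.
have r0 : r != 0.
  apply: contraNneq Fy => r0; have := rE 0.
  by rewrite r0 horner0 scale0r addr0 => <-.
have [rs rsE] := closed_field_poly_normal r.
pose pts := [seq c <- z :: [seq y + u *: z | u <- rs] | c != 0].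
have [||c cpts Xc] :=
  @irreducible_finite_cover K n X _ pts (fun c x => X x /\ (f x == c)%MS) irX.
- by move=> c; rewrite mem_filter => /andP[c0 _]; apply: fiber_closed.
- move=> x Xx; have fx := pclosed_neq0 cY (fY x Xx).
  suff [c cp fc] : exists2 c, c \in z :: [seq y + u *: z | u <- rs] & (f x == c)%MS.
    by exists c => //; rewrite mem_filter cp -(same_point_neq0 fc) fx.
  have [a [b fE]] := hz _ (fXL x Xx).
  case: (eqVneq a 0) => [a0|a0].
    exists z; first by rewrite mem_head.
    rewrite fE a0 scale0r add0r scale_same_point //.
    by apply: contraNneq fx => b0; rewrite fE a0 b0 !scale0r addr0.
  have fE' : f x = a *: (y + (b / a) *: z).
    by rewrite scalerDr scalerA mulrC divfK.
  exists (y + (b / a) *: z); last by rewrite fE' scale_same_point.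
  rewrite inE; apply/orP; right; apply/mapP; exists (b / a) => //.
  rewrite -root_prod_XsubC; have := FY _ (fY x Xx).
  rewrite fE' (form_scale _ _ hF) -rE => /eqP; rewrite mulf_eq0 expf_eq0 (negbTE a0) andbF /=.
  by rewrite {1}rsE hornerZ mulf_eq0 lead_coef_eq0 (negbTE r0) rootE.
have one x x' : X x -> X x' -> (x == x')%MS.
  move=> Xx Xx'; have [_ fx] := Xc x Xx; have [_ fx'] := Xc x' Xx'.
  apply: same_point_trans (same_point_sym (gf x Xx)) _.
  apply: same_point_trans (gf x' Xx').
  apply: (regular_same_point cY rg (fY x Xx)).
  exact: same_point_trans fx (same_point_sym fx').
have [_ nZ] := sZ 0%N isT; apply: nZ => x1 Z1x1.
have [cZ0 [[x0 Z0x0] _] Z0X] := hZ 0%N isT.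
have [_ _ Z1X] := hZ 1%N isT.
by apply: (pclosed_same_point cZ0 _ Z0x0); apply: one; [exact: Z0X|exact: Z1X].
Qed.

(** Linear coordinates on the line identify it with the projective line. *)
Lemma isomorphic_line n m (X : pset K n) (f : 'rV[K]_n.+1 -> 'rV[K]_m.+1)
    (L : 'M[K]_(2, m.+1)) :
  embedding X f -> row_free L -> (forall x, X x -> (f x <= L)%MS) ->
  (forall y, y != 0 -> (y <= L)%MS -> pimage X f y) ->
  isomorphic X (@pspace K 1).
Proof.
move=> [cY [[rf fY] [g [[rg gX] gf fg]]]] fL fXL onto.
have LB : L *m pinvmx L = 1%:M by apply: mulmxVp.
have inL (y : 'rV[K]_m.+1) : (y <= L)%MS -> y *m pinvmx L *m L = y by exact: mulmxKpV.
have nzL (y : 'rV[K]_m.+1) : y != 0 -> (y <= L)%MS -> y *m pinvmx L != 0.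
  by move=> y0 yL; apply: contraNneq y0 => h; rewrite -(inL y yL) h mul0mx.
have nzc (c : 'rV[K]_2) : c != 0 -> c *m L != 0.
  by apply: contraNneq => h; rewrite -[c]mulmx1 -LB mulmxA h mul0mx.
exists (fun x => f x *m pinvmx L); split.
  split=> [x Xx|x Xx]; last first.
    by apply: nzL (fXL x Xx); apply: pclosed_neq0 (fY x Xx).
  have [d [F [hF Fx fF]]] := rf x Xx.
  have [hFB fFB] := represents_mul (pinvmx L) (conj hF fF).
  exists d, (fun i => pencil F (col i (pinvmx L))); split=> //.
  rewrite poly_map_mul; apply: nzL => //.
  have /same_point_sym/same_point_scale[a _ ->] := fF x Xx Fx.
  by apply: scalemx_sub; apply: fXL.
exists (fun c => g (c *m L)); split.
- split=> [c c0|c c0]; last by apply: gX; apply: onto; [exact: nzc|exact: submxMl].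
  have [d [G [hG Gc gG]]] := rg _ (onto _ (nzc c c0) (submxMl _ _)).
  pose GL i := G i \mPo [tuple linform (col j L) | j < m.+1].
  have GLE (x : 'rV[K]_2) : poly_map GL x = poly_map G (x *m L).
    apply/rowP => i; rewrite !mxE comp_mpoly_meval; apply: meval_eq => j.
    rewrite tnth_mktuple linformE !mxE; apply: eq_bigr => k _.
    by rewrite [col _ _ _ _]mxE.
  exists (1 * d)%N, GL; split; [|by rewrite GLE|].
    by move=> i; apply: form_comp => // j; exact: linform_form.
  move=> x x0; rewrite GLE => Gx; apply: gG => //.
  by apply: onto; [exact: nzc|exact: submxMl].
- move=> x Xx; rewrite inL; [exact: gf|exact: fXL].
- move=> c c0; have cL := onto _ (nzc c c0) (submxMl _ _).
  have := same_point_mul (pinvmx L) (fg _ cL).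
  by rewrite -(mulmxA c) LB mulmx1.
Qed.

(** A hyperplane h that does not contain the line meets it in the kernel of the
nonzero column L h^T, which is a single point. *)
Lemma line_degree m (Y : pset K m) (L : 'M[K]_(2, m.+1)) d : row_free L ->
  (forall y, Y y <-> y != 0 /\ (y <= L)%MS) -> curve_degree Y d -> d = 1%N.
Proof.
move=> fL YE [U [_ dU secU]].
have Lh (h : 'rV[K]_m.+1) i : (L *m h^T) i 0 = (h *m (row i L)^T) 0 0.
  by rewrite !mxE; apply: eq_bigr => k _; rewrite !mxE mulrC.
have [||h [Uh Vh]] := dU (fun h => L *m h^T != 0).
- split=> [h|]; first by apply: contraNneq => ->; rewrite trmx0 mulmx0.
  apply: pclosed_intro => [x []//|h h0 hV].
  have Vh : L *m h^T != 0 by apply: contrapT => Vh; apply: hV.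
  have [i Li] : exists i, (L *m h^T) i 0 != 0.
    apply: contrapT => hn; move/eqP: Vh; apply; apply/colP => i; rewrite [RHS]mxE.
    by apply: contrapT => /eqP hi; apply: hn; exists i.
  exists 1%N, (linform (row i L)^T); split; first exact: linform_form.
    move=> y [y0 Vy]; rewrite linformE -Lh.
    have -> : L *m y^T = 0 by apply: contrapT => /eqP.
    by rewrite mxE.
  by rewrite linformE -Lh.
- have [i /rV0Pn[j ij]] : exists i, row i L != 0.
    apply: contrapT => hn; have L0 : L = 0.
      apply/row_matrixP => i; rewrite row0; apply: contrapT => /eqP hi.
      by apply: hn; exists i.
    by move: fL; rewrite L0 /row_free mxrank0.
  exists (delta_mx 0 j); apply: contraNneq ij => Lj.
  have := congr1 (fun M : 'cV_2 => M i 0) Lj.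
  by rewrite trmx_delta -colE !mxE => ->.
have [p [Yp pinj pcov]] := secU h Uh.
pose k := kermx (L *m h^T).
have rk : \rank k = 1%N.
  rewrite mxrank_ker; suff -> : \rank (L *m h^T) = 1%N by [].
  by apply/eqP; rewrite eqn_leq rank_leq_col lt0n mxrank_eq0.
have [i0 _] : exists i : 'I_d, True.
  have : k != 0 by rewrite -mxrank_eq0 rk.
  move=> /rowV0Pn[c /sub_kermxP ck c0].
  have [|i _] := pcov (c *m L); last by exists i.
  split; last by rewrite -mulmxA.
  apply/YE; split; last exact: submxMl.
  by apply: contraNneq c0 => cL; rewrite -(mulmx1 c) -(mulmxVp fL) mulmxA cL mul0mx.
have alleq (i j : 'I_d) : i = j.
  have lift (q : 'I_d) : exists2 c : 'rV[K]_2, p q = c *m L & (c == k)%MS.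
    have [/YE[pq0 /submxP[c pqE]] pqh] := Yp q; exists c => //.
    have ck : (c <= k)%MS by apply/sub_kermxP; rewrite mulmxA -pqE.
    have c0 : c != 0 by apply: contraNneq pq0 => c0; rewrite pqE c0 mul0mx.
    by rewrite ck /= -(mxrank_leqif_sup ck) rk rank_rV c0.
  apply: pinj; have [ci -> /eqmxP cik] := lift i; have [cj -> /eqmxP cjk] := lift j.
  apply: same_point_mul; apply/eqmxP; exact: eqmx_trans cik (eqmx_sym cjk).
case: d p {secU Yp pinj pcov} i0 alleq => [|[|d]] _ // i0 alleq; first by case: i0.
by have := alleq ord0 ord_max; move/(congr1 val).
Qed.

Lemma translated_line_degree n (C : pset K n) (f : 'rV[K]_n.+1 -> 'rV[K]_4)
    (g : 'M[K]_4) (L : 'M[K]_(2, 4)) d : g \in unitmx -> row_free L ->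
  (forall x, C x -> (f x <= L)%MS) ->
  (forall y, y != 0 -> (y <= L)%MS -> pimage C f y) ->
  curve_degree (pimage C (translate g f)) d -> d = 1%N.
Proof.
move=> ug fL fCL onto; apply: (@line_degree 3 _ (L *m g)).
  by rewrite /row_free mxrankMfree ?row_free_unit //; exact: fL.
move=> y; split=> [[y0 [x [Cx yx]]]|[y0 /submxP[D yE]]].
  split=> //; have /andP[h _] := yx; apply: submx_trans h _.
  by apply: submxMr; apply: fCL.
split=> //; have DL0 : D *m L != 0.
  by apply: contraNneq y0 => h; rewrite yE mulmxA h mul0mx.
have [_ [x [Cx Dx]]] := onto _ DL0 (submxMl _ _).
by exists x; split=> //; rewrite yE mulmxA; exact: same_point_mul.
Qed.

End Lines.

(** * The complex numbers are uncountable *)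

Lemma avoid_finite (R : realType) (s : seq R) (a b : R) : a < b ->
  exists a' b', [/\ a <= a', a' < b', b' <= b &
    forall c, c \in s -> ~~ (a' <= c <= b')].
Proof.
elim: s a b => [|c s IH] a b ab; first by exists a, b.
have [a1 [b1 [aa1 ab1 bb1 hc]]] : exists a1 b1,
    [/\ a <= a1, a1 < b1, b1 <= b & ~~ (a1 <= c <= b1)].
  case: (lerP c ((a + b) / 2)) => hc.
    by exists ((a + 3 * b) / 4), b; split; [lra|lra|lra|apply/negP => /andP[]; lra].
  by exists a, ((a + b) / 2); split; [lra|lra|lra|apply/negP => /andP[]; lra].
have [a2 [b2 [aa2 ab2 bb2 hs]]] := IH a1 b1 ab1.
exists a2, b2; split=> //; [exact: le_trans aa1 aa2|exact: le_trans bb2 bb1|].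
move=> x; rewrite inE => /orP[/eqP->|/hs//].
apply: contra hc => /andP[h1 h2].
by rewrite (le_trans aa2 h1) (le_trans h2 bb2).
Qed.

(** Were all the sets where phi is at most k finite, nested intervals avoiding
them one after the other would contain a real number outside all of them. *)
Lemma uncountable_real (R : realType) : uncountable R.
Proof.
move=> phi; apply: contrapT => nk.
have fin k : exists s : seq R, forall c, (phi c <= k)%N -> c \in s.
  have [m hm] : exists m, forall s : seq R, uniq s ->
      (forall c, c \in s -> (phi c <= k)%N) -> (size s < m)%N.
    apply: contrapT => hn; apply: nk; exists k => m; apply: contrapT => hs.
    apply: hn; exists m => s us sk; rewrite ltnNge; apply/negP => ms.
    by apply: hs; exists s.
  pose P r := `[< exists s : seq R, [/\ uniq s, size s = r &
    forall c, c \in s -> (phi c <= k)%N] >].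
  have exP : exists r, P r by exists 0%N; apply/asboolP; exists [::].
  have bP r : P r -> (r <= m)%N.
    by move=> /asboolP[s [us <- sk]]; apply/ltnW/hm.
  have [r /asboolP[s [us sr sk]] maxr] := ex_maxnP exP bP.
  exists s => c ck; apply: contrapT => /negP cs.
  suff : P r.+1 by move/maxr; rewrite ltnn.
  apply/asboolP; exists (c :: s); split; rewrite /= ?sr ?cs //.
  by move=> x; rewrite inE => /orP[/eqP->|/sk].
have [s hs] := choice fin.
have step k (I : R * R) : exists J : R * R, I.1 < I.2 ->
    [/\ I.1 <= J.1, J.1 < J.2, J.2 <= I.2 & forall c, c \in s k -> ~~ (J.1 <= c <= J.2)].
  case: (ltrP I.1 I.2) => [lt|_]; last by exists I.
  by have [a [b h]] := avoid_finite (s k) lt; exists (a, b).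
have [next hnext] := choice (fun kI : nat * (R * R) => step kI.1 kI.2).
pose I := fix I k := if k is j.+1 then next (j, I j) else (0, 1).
have ltI k : (I k).1 < (I k).2.
  elim: k => [|k IH] /=; first by rewrite ltr01.
  by have [] := hnext (k, I k) IH.
have subI k j : (I k).1 <= (I (k + j)%N).1 /\ (I (k + j)%N).2 <= (I k).2.
  elim: j => [|j [IH1 IH2]]; first by rewrite addn0.
  rewrite addnS /=; have [h1 _ h2 _] := hnext ((k + j)%N, I (k + j)%N) (ltI _).
  by split; [apply: le_trans h1|apply: le_trans h2 _].
have cross i j : (I i).1 <= (I j).2.
  have [ij|/ltnW ji] := leqP i j.
    rewrite -(subnKC ij); have [h _] := subI i (j - i)%N.
    by apply: le_trans h (ltW (ltI _)).
  rewrite -(subnKC ji); have [_ h] := subI j (i - j)%N.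
  by apply: le_trans (ltW (ltI _)) h.
pose A : set R := [set x | exists i, x = (I i).1]%classic.
have supA : has_sup A.
  split; first by exists (I 0%N).1, 0%N.
  by exists (I 0%N).2 => x [i ->].
have inI k : (I k).1 <= sup A <= (I k).2.
  apply/andP; split; first by apply: sup_upper_bound => //; exists k.
  by apply: ge_sup; [exact: supA.1|move=> x [i ->]].
have [_ _ _ /(_ (sup A))] := hnext (phi (sup A), I (phi (sup A))) (ltI _).
by move=> /(_ (hs _ _ (leqnn _)))/negP; apply; exact: (inI (phi (sup A)).+1).
Qed.

Lemma uncountable_complex (R : realType) : uncountable R[i].
Proof.
move=> phi; have [k hk] := uncountable_real (fun x : R => phi (Complex x 0)).
exists k => m; have [s [us ms sk]] := hk m.
exists [seq Complex x 0 | x <- s]; rewrite size_map; split=> //.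
  by rewrite map_inj_uniq // => x y [].
by move=> _ /mapP[x /sk xk ->].
Qed.

(** * Skew generic scrolls *)

Section Scrolls.
Variable K : numClosedFieldType.
Implicit Types (n m d e : nat).

Definition frame m (u1 u2 u3 u4 : 'rV[K]_m) : 'M[K]_((1 + 1) + (1 + 1), m) :=
  col_mx (col_mx u1 u2) (col_mx u3 u4).

Lemma polyfun_frame (U1 U2 U3 U4 : 'M[K]_4 -> 'M[K]_4 -> 'rV[K]_4) :
  (forall j, polyfun (fun g h => U1 g h 0 j)) ->
  (forall j, polyfun (fun g h => U2 g h 0 j)) ->
  (forall j, polyfun (fun g h => U3 g h 0 j)) ->
  (forall j, polyfun (fun g h => U4 g h 0 j)) ->
  polyfun (fun g h => \det (frame (U1 g h) (U2 g h) (U3 g h) (U4 g h))).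
Proof.
move=> h1 h2 h3 h4; apply: polyfun_det => i j.
case: (split_ordP i) => i' ->; case: (split_ordP i') => i'' ->;
  rewrite ord1 /frame.
- by have [A AE] := h1 j; exists A => g h; rewrite !col_mxEu AE.
- by have [A AE] := h2 j; exists A => g h; rewrite col_mxEu col_mxEd AE.
- by have [A AE] := h3 j; exists A => g h; rewrite col_mxEd col_mxEu AE.
- by have [A AE] := h4 j; exists A => g h; rewrite !col_mxEd AE.
Qed.

Definition unit_row (i : 'I_((1 + 1) + (1 + 1))) : 'rV[K]_4 := delta_mx 0 i.

Lemma frame_unit : \det (frame (unit_row (lshift _ (lshift _ ord0)))
  (unit_row (lshift _ (rshift _ ord0))) (unit_row (rshift _ (lshift _ ord0)))
  (unit_row (rshift _ (rshift _ ord0)))) = 1.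
Proof.
apply: etrans (det1 _ 4); congr (\det _); apply/matrixP => i j.
rewrite [RHS]mxE eq_sym.
by case: (split_ordP i) => i' ->; case: (split_ordP i') => i'' ->;
  rewrite (ord1 i'') /frame ?col_mxEu ?col_mxEd ?col_mxEu ?col_mxEd mxE eqxx.
Qed.

Lemma row_free_image n m p (A : 'M[K]_(n, m)) (B : 'M[K]_(n, p)) :
  row_free A -> exists g, A *m g = B.
Proof. by move=> fA; exists (pinvmx A *m B); rewrite mulmxA mulmxVp // mul1mx. Qed.

Lemma frame_kernel (u1 u2 u3 u4 : 'rV[K]_4) (b : 'cV[K]_4) :
  \det (frame u1 u2 u3 u4) != 0 -> (u1 *m b) 0 0 = 0 -> (u2 *m b) 0 0 = 0 ->
  (u3 *m b) 0 0 = 0 -> (u4 *m b) 0 0 = 0 -> b = 0.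
Proof.
move=> fr h1 h2 h3 h4.
have z (u : 'rV[K]_4) : (u *m b) 0 0 = 0 -> u *m b = 0.
  by move=> h; apply/matrixP => i j; rewrite !ord1 h mxE.
have uf : frame u1 u2 u3 u4 \in unitmx by rewrite unitmxE unitfE.
have Mb : frame u1 u2 u3 u4 *m b = 0.
  rewrite /frame !mul_col_mx (z u1) // (z u2) // (z u3) // (z u4) //.
  by rewrite !col_mx0.
by rewrite -(mulKmx uf b) Mb mulmx0.
Qed.

(** Two elements of the dual basis of the frame: they are coordinates on the pencil
of planes through the line joining u1 and u2. *)
Lemma frame_coordinates (u1 u2 u3 u4 : 'rV[K]_4) :
  \det (frame u1 u2 u3 u4) != 0 -> exists a b : 'cV[K]_4,
    [/\ (u1 *m a) 0 0 = 0, (u2 *m a) 0 0 = 0, (u3 *m a) 0 0 = 1 & (u4 *m a) 0 0 = 0] /\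
    [/\ (u1 *m b) 0 0 = 0, (u2 *m b) 0 0 = 0, (u3 *m b) 0 0 = 0 & (u4 *m b) 0 0 = 1] /\
    (forall y : 'rV[K]_4, (y *m a) 0 0 = 0 -> (y *m b) 0 0 = 0 -> (y <= u1 + u2)%MS).
Proof.
move=> fr; pose M : 'M[K]_((1 + 1) + (1 + 1)) := frame u1 u2 u3 u4.
have uM : M \in unitmx by rewrite unitmxE unitfE.
pose c j := col j (invmx M).
have mb i j : (row i M *m c j) 0 0 = (i == j)%:R.
  by rewrite /c colE mulmxA -row_mul mulmxV // -colE !mxE.
have r1 : row (lshift _ (lshift _ ord0)) M = u1.
  by apply/rowP => k; rewrite mxE !col_mxEu.
have r2 : row (lshift _ (rshift _ ord0)) M = u2.
  by apply/rowP => k; rewrite mxE col_mxEu col_mxEd.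
have r3 : row (rshift _ (lshift _ ord0)) M = u3.
  by apply/rowP => k; rewrite mxE col_mxEd col_mxEu.
have r4 : row (rshift _ (rshift _ ord0)) M = u4.
  by apply/rowP => k; rewrite mxE !col_mxEd.
exists (c (rshift _ (lshift _ ord0))), (c (rshift _ (rshift _ ord0))).
split; first by split; rewrite -?r1 -?r2 -?r3 -?r4 mb.
split; first by split; rewrite -?r1 -?r2 -?r3 -?r4 mb.
move=> y ya yb; rewrite -(mulmxKV uM y).
rewrite -[y *m invmx M]hsubmxK.
have -> : rsubmx (y *m invmx M) = 0.
  apply/rowP => j; rewrite [RHS]mxE mxE.
  have yc k : (y *m invmx M) 0 k = (y *m c k) 0 0.
    by rewrite !mxE; apply: eq_bigr => l _; rewrite [c _ _ _]mxE.
  by rewrite yc; case: (split_ordP j) => j' ->; rewrite ord1.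
by rewrite /M /frame mul_row_col mul0mx addr0 (addsmxE u1 u2) submxMl.
Qed.

(** If some point y of X is not on the line spanned by p and w, the three vectors
are independent and g moves them freely, while h moves q; so the determinant is
not identically zero. *)
Lemma generic_plane (X : 'rV[K]_4 -> Prop) (p w q : 'rV[K]_4) :
  row_free (col_mx p w) -> q != 0 ->
  exists P, [/\ polyfun P, exists g h, P g h != 0 &
    forall g h, P g h != 0 -> (forall y, X y -> (y <= col_mx p w)%MS) \/
      exists2 y, X y & \det (frame (p *m g) (q *m h) (w *m g) (y *m g)) != 0].
Proof.
move=> fpw q0; case: (pselect (forall y, X y -> (y <= col_mx p w)%MS)) => inL.
  exists (fun _ _ => 1); split; first exact: polyfun_const.
    by exists 1, 1; rewrite oner_neq0.
  by left.
have [y Xy yL] : exists2 y, X y & ~ (y <= col_mx p w)%MS.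
  apply: contrapT => hn; apply: inL => y Xy; apply: contrapT => yL.
  by apply: hn; exists y.
have fy : row_free (col_mx (col_mx p w) y).
  by apply: row_free_extend => //; apply/negP.
exists (fun g h => \det (frame (p *m g) (q *m h) (w *m g) (y *m g))); split.
- by apply: polyfun_frame => j; [exact: polyfun_rowl|exact: polyfun_rowr|
    exact: polyfun_rowl|exact: polyfun_rowl].
- have [g] := row_free_image (col_mx (col_mx (unit_row (lshift _ (lshift _ ord0)))
    (unit_row (rshift _ (lshift _ ord0)))) (unit_row (rshift _ (rshift _ ord0)))) fy.
  rewrite !mul_col_mx => /eq_col_mx[/eq_col_mx[pg wg] yg].
  have [h qh] := row_free_image (unit_row (lshift _ (rshift _ ord0))) (row_free_row q0).
  by exists g, h; rewrite pg wg yg qh frame_unit oner_neq0.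
- by move=> g h d0; right; exists y.
Qed.

(** If the determinant vanished, some nonzero combination of y1 and y2 would be
killed by a and b, and so be a common point of the two lines. *)
Lemma disjoint_lines_coordinates m (u1 u2 y1 y2 : 'rV[K]_m) (a b : 'cV[K]_m) :
  (forall y : 'rV[K]_m, (y *m a) 0 0 = 0 -> (y *m b) 0 0 = 0 -> (y <= u1 + u2)%MS) ->
  ((y1 + y2) :&: (u1 + u2))%MS = 0 -> (exists k l, minor2 y1 y2 k l != 0) ->
  (y1 *m a) 0 0 * (y2 *m b) 0 0 - (y1 *m b) 0 0 * (y2 *m a) 0 0 != 0.
Proof.
move=> uab cap0 [k [l kl]]; apply: contraNneq kl => G0.
have lin (x1 x2 : K) (c : 'cV[K]_m) :
    ((x1 *: y1 - x2 *: y2) *m c) 0 0 = x1 * (y1 *m c) 0 0 - x2 * (y2 *m c) 0 0.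
  by rewrite mulmxBl -!scalemxAl !mxE.
have comb x1 x2 : x1 * (y1 *m a) 0 0 - x2 * (y2 *m a) 0 0 = 0 ->
    x1 * (y1 *m b) 0 0 - x2 * (y2 *m b) 0 0 = 0 ->
    x1 * minor2 y1 y2 k l = 0 /\ x2 * minor2 y1 y2 k l = 0.
  move=> h1 h2; have : (x1 *: y1 - x2 *: y2 <= (y1 + y2) :&: (u1 + u2))%MS.
    rewrite sub_capmx uab ?lin // andbT -scaleNr.
    by apply: addmx_sub_adds; apply: scalemx_sub.
  rewrite cap0 submx0 subr_eq0 => /eqP E.
  split.
    have -> : x1 * minor2 y1 y2 k l = minor2 (x1 *: y1) y2 k l.
      by rewrite /minor2 !mxE; ring.
    by rewrite E /minor2 !mxE; ring.
  have -> : x2 * minor2 y1 y2 k l = minor2 y1 (x2 *: y2) k l.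
    by rewrite /minor2 !mxE; ring.
  by rewrite -E /minor2 !mxE; ring.
have [|| _ A2] := comb ((y2 *m a) 0 0) ((y1 *m a) 0 0).
- by rewrite mulrC subrr.
- by rewrite -[RHS]oppr0 -G0; ring.
have [|| _ B2] := comb ((y2 *m b) 0 0) ((y1 *m b) 0 0).
- by rewrite -[RHS]G0; ring.
- by rewrite mulrC subrr.
case: (eqVneq (minor2 y1 y2 k l) 0) => [//|m0].
have z (x : K) : x * minor2 y1 y2 k l = 0 -> x = 0.
  by move=> /eqP; rewrite mulf_eq0 (negbTE m0) orbF => /eqP.
have [] : 1 * minor2 y1 y2 k l = 0 /\ 0 * minor2 y1 y2 k l = 0.
  by apply: comb; rewrite ?(z _ A2) ?(z _ B2); ring.
by rewrite mul1r => m00; rewrite m00 eqxx in m0.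
Qed.

(** These singular matrices send j1 to the last two coordinates and j2 to the
first two, so that the images are independent once both are nonzero.  This is the
pair of matrices around which disjointness is propagated. *)
Lemma minor2_misses_line (j1 j2 : 'rV[K]_4) (a b a' b' : 'cV[K]_4) :
  ((j1 *m a) 0 0 != 0) || ((j1 *m b) 0 0 != 0) ->
  ((j2 *m a') 0 0 != 0) || ((j2 *m b') 0 0 != 0) ->
  exists k l, minor2 (j1 *m row_mx (0 : 'M_(4, 1 + 1)) (row_mx a b))
    (j2 *m row_mx (row_mx a' b') (0 : 'M_(4, 1 + 1))) k l != 0.
Proof.
rewrite !mul_mx_row !mulmx0.
have val (u u' w w' : 'rV[K]_1) (k l : 'I_(1 + 1)) :
    minor2 (row_mx 0 (row_mx u u')) (row_mx (row_mx w w') 0)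
      (rshift (1 + 1) k) (lshift (1 + 1) l) = row_mx u u' 0 k * row_mx w w' 0 l.
  by rewrite /minor2 !row_mxEl !row_mxEr [X in _ - X * _]mxE mul0r subr0.
move=> /orP[ja|ja] /orP[jb|jb].
- exists (rshift (1 + 1) (lshift 1 ord0)), (lshift (1 + 1) (lshift 1 ord0)).
  by rewrite val ?row_mxEl ?row_mxEr mulf_neq0.
- exists (rshift (1 + 1) (lshift 1 ord0)), (lshift (1 + 1) (rshift 1 ord0)).
  by rewrite val ?row_mxEl ?row_mxEr mulf_neq0.
- exists (rshift (1 + 1) (rshift 1 ord0)), (lshift (1 + 1) (lshift 1 ord0)).
  by rewrite val ?row_mxEl ?row_mxEr mulf_neq0.
- exists (rshift (1 + 1) (rshift 1 ord0)), (lshift (1 + 1) (rshift 1 ord0)).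
  by rewrite val ?row_mxEl ?row_mxEr mulf_neq0.
Qed.

(** General hyperplane sections being finite, some line is disjoint from the
translated curve; its preimage under g is disjoint from the curve itself. *)
Lemma translate_misses_line n (C : pset K n) (f : 'rV[K]_n.+1 -> 'rV[K]_4) g d :
  embedding C (translate g f) -> curve_degree (pimage C (translate g f)) d ->
  exists a b : 'cV[K]_4, forall x, C x -> ((f x *m a) 0 0 != 0) || ((f x *m b) 0 0 != 0).
Proof.
move=> [cY [[_ fY] _]] deg.
have [|a [b hab]] := curve_misses_line _ deg; first by move=> y /(pclosed_neq0 cY).
exists (g *m a), (g *m b) => x Cx.
by rewrite !mulmxA; exact: hab _ (fY x Cx).
Qed.

(** At generic position the projection from the ruling through s confines
j1(C) to the plane spanned by its tangent line at s and by j2(s).  If f(C) left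
its tangent line T, some point y of it would be carried by G out of that plane. *)
Lemma skew_scroll_line n (C : pset K n) (f j1 j2 : 'rV[K]_n.+1 -> 'rV[K]_4)
    (G : 'M[K]_4) (T : 'M[K]_(2, 4)) s v tau e Q d1 d2 F1 F2 :
  uncountable K -> pclosed C -> irreducible C -> C s -> local_param C s v tau e Q ->
  regular C j1 -> regular C j2 -> represents C j1 d1.+1 F1 ->
  represents C j2 d2.+1 F2 -> poly_map F1 s != 0 -> poly_map F2 s != 0 ->
  \det (frame (poly_map F1 s) (poly_map F2 s) (dif_map F1 s v) (dif_map F2 s v)) != 0 ->
  skew_scroll C j1 j2 ->
  (forall x, C x -> exists k l, minor2 (j1 x) (j2 x) k l != 0) ->
  (forall x, C x -> (f x *m G == j1 x)%MS) ->
  (forall y, pimage C f y -> (y <= T)%MS) \/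
  (exists2 y, pimage C f y &
    \det (frame (poly_map F1 s) (poly_map F2 s) (dif_map F1 s v) (y *m G)) != 0) ->
  forall y, pimage C f y -> (y <= T)%MS.
Proof.
move=> uncK cC irC Cs par r1 r2 rep1 rep2 p1 p2 fr skew indep fG.
case=> [//|[y [_ [x [Cx yx]]] fry]]; exfalso.
have [a [b [[a1 a2 a3 a4] [[b1 b2 b3 b4] hab]]]] := frame_coordinates fr.
have jb : forall x, C x -> (j1 x *m b) 0 0 = 0.
  apply: (projection_from_ruling uncK cC irC Cs par r1 r2 rep1 rep2 p1 (a := a)) => //.
  - by move=> c [] ->.
  - by rewrite a3 oner_neq0.
  - by rewrite b4 oner_neq0.
  - move=> z Cz zs; apply: (disjoint_lines_coordinates (u1 := j1 s) (u2 := j2 s)) => //.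
    + move=> u ua ub; apply: submx_trans (hab u ua ub) _.
      have /andP[_ h1] := rep1.2 s Cs p1; have /andP[_ h2] := rep2.2 s Cs p2.
      exact: addsmxS.
    + exact: skew.
    + exact: indep.
have yb : (y *m G *m b) 0 0 = 0.
  have /same_point_scale[c _ ->] := same_point_trans (same_point_mul G yx) (fG x Cx).
  by rewrite -scalemxAl mxE jb // mulr0.
have b0 := frame_kernel fry b1 b2 b3 yb.
by move: b4; rewrite b0 mulmx0 mxE => /eqP; rewrite eq_sym oner_eq0.
Qed.

Lemma skew_scrollC n (C : pset K n) (j1 j2 : 'rV[K]_n.+1 -> 'rV[K]_4) :
  skew_scroll C j1 j2 -> skew_scroll C j2 j1.
Proof. by move=> sk t s Ct Cs ts; rewrite addsmxC (addsmxC (j2 s)); exact: sk. Qed.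

Lemma col_mx_supl n1 n2 m (A : 'M[K]_(n1, m)) (B : 'M[K]_(n2, m)) :
  (A <= col_mx A B)%MS.
Proof. by rewrite -(addsmxE A B) addsmxSl. Qed.

Lemma col_mx_supr n1 n2 m (A : 'M[K]_(n1, m)) (B : 'M[K]_(n2, m)) :
  (B <= col_mx A B)%MS.
Proof. by rewrite -(addsmxE A B) addsmxSr. Qed.

Lemma det_frame_swap (u1 u2 u3 u4 : 'rV[K]_4) :
  \det (frame u1 u2 u3 u4) != 0 -> \det (frame u2 u1 u4 u3) != 0.
Proof.
have unitE (M : 'M[K]_4) : (\det M != 0) = (1%:M <= M)%MS.
  by rewrite -unitfE -unitmxE -row_full_unit sub1mx.
have l1 (u v w x : 'rV[K]_4) : (u <= frame u v w x)%MS.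
  exact: submx_trans (col_mx_supl u v) (col_mx_supl _ _).
have l2 (u v w x : 'rV[K]_4) : (v <= frame u v w x)%MS.
  exact: submx_trans (col_mx_supr u v) (col_mx_supl _ _).
have l3 (u v w x : 'rV[K]_4) : (w <= frame u v w x)%MS.
  exact: submx_trans (col_mx_supl w x) (col_mx_supr _ _).
have l4 (u v w x : 'rV[K]_4) : (x <= frame u v w x)%MS.
  exact: submx_trans (col_mx_supr w x) (col_mx_supr _ _).
have sub : (frame u1 u2 u3 u4 <= frame u2 u1 u4 u3)%MS.
  by rewrite {1}/frame !col_mx_sub l1 l2 l3 l4.
by rewrite !unitE => /submx_trans; apply; exact: sub.
Qed.

(** The generic conditions, for a fixed point s: the tangent lines at s do not
meet (P1); each curve is contained in its tangent line at s or leaves the plane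
spanned by this line and the point of the other curve (P2, P3); corresponding
points are always distinct (P4).  If one of the curves met every line, it would
have no degree and there would be no scroll to speak of. *)
Lemma skew_generic_scroll n (C : pset K n)
    (iota1 iota2 : 'rV[K]_n.+1 -> 'rV[K]_4) : uncountable K ->
  smooth_curve C -> embedding C iota1 -> embedding C iota2 ->
  generically (fun g1 g2 : 'M[K]_4 =>
    forall (d1 d2 : nat) (S : pset K 3),
      scroll C (translate g1 iota1) (translate g2 iota2) d1 d2 S ->
      skew_scroll C (translate g1 iota1) (translate g2 iota2) ->
      isomorphic C (@pspace K 1) /\ d1 = 1%N /\ d2 = 1%N).
Proof.
move=> uncK [cC irC [chC _] smC] emb1 emb2.
have [[s Cs] _] := irC.
have [v [tau [e [Q [[tv vs _ _] par]]]]] := local_parameter cC smC Cs.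
have [[r1 _] _] := emb1.2; have [[r2 _] _] := emb2.2.
have [d1 [F1 [rep1 p10]]] := regular_represented cC r1 Cs.
have [d2 [F2 [rep2 p20]]] := regular_represented cC r2 Cs.
have pw1 := row_free_pair p10 (embedding_immersion cC emb1 Cs tv vs rep1 p10).
have pw2 := row_free_pair p20 (embedding_immersion cC emb2 Cs tv vs rep2 p20).
pose misses (f : 'rV[K]_n.+1 -> 'rV[K]_4) := exists a b : 'cV[K]_4,
  forall x, C x -> ((f x *m a) 0 0 != 0) || ((f x *m b) 0 0 != 0).
case: (pselect (misses iota1 /\ misses iota2)) => [[mis1 mis2]|nomis]; last first.
  apply: (generically_polyfun (polyfun_const _ 1)).
    by exists 1, 1; rewrite oner_neq0.
  move=> a b g h _ _ _ _ _ D1 D2 S [_ [e1 deg1] [e2 deg2] _] _; exfalso; apply: nomis.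
  by split; [apply: translate_misses_line e1 deg1|apply: translate_misses_line e2 deg2].
have [a1 [b1 hab1]] := mis1; have [a2 [b2 hab2]] := mis2.
have [P4 [pP4 nP4 hP4]] := disjointness_open uncK cC r1 r2
  (fun x Cx => minor2_misses_line (hab1 x Cx) (hab2 x Cx)).
set p1 := poly_map F1 s in p10 pw1; set p2 := poly_map F2 s in p20 pw2.
set w1 := dif_map F1 s v in pw1; set w2 := dif_map F2 s v in pw2.
have [P2 [pP2 nP2 hP2]] := generic_plane (pimage C iota1) pw1 p20.
have [P3 [pP3 [h3 [g3 nP3]] hP3]] := generic_plane (pimage C iota2) pw2 p10.
pose P1 (g h : 'M[K]_4) := \det (frame (p1 *m g) (p2 *m h) (w1 *m g) (w2 *m h)).
have pP1 : polyfun P1.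
  by apply: polyfun_frame => j; [exact: polyfun_rowl|exact: polyfun_rowr|
    exact: polyfun_rowl|exact: polyfun_rowr].
have nP1 : exists g h, P1 g h != 0.
  have [g] := row_free_image (col_mx (unit_row (lshift _ (lshift _ ord0)))
    (unit_row (rshift _ (lshift _ ord0)))) pw1.
  rewrite mul_col_mx => /eq_col_mx[pg wg].
  have [h] := row_free_image (col_mx (unit_row (lshift _ (rshift _ ord0)))
    (unit_row (rshift _ (rshift _ ord0)))) pw2.
  rewrite mul_col_mx => /eq_col_mx[ph wh].
  by exists g, h; rewrite /P1 pg wg ph wh frame_unit oner_neq0.
have pP3' := polyfun_swap pP3.
have nP3' : exists g h, P3 h g != 0 by exists g3, h3.
have {}nP4 : exists g h, P4 g h != 0 by do 2!eexists; exact: nP4.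
have nP34 := polyfun_common_nonzero pP3' pP4 nP3' nP4.
have pP34 := polyfunM pP3' pP4.
have nP234 := polyfun_common_nonzero pP2 pP34 nP2 nP34.
have pP234 := polyfunM pP2 pP34.
have nP := polyfun_common_nonzero pP1 pP234 nP1 nP234.
apply: (generically_polyfun (polyfunM pP1 pP234) nP).
move=> a b g h a0 b0 ug uh; rewrite !mulf_eq0 !negb_or.
move=> /andP[P1n /andP[/hP2 P2n /andP[/hP3 P3n /hP4 P4n]]].
move=> D1 D2 S [_ [_ deg1] [_ deg2] _] sk.
have indep x : C x -> exists k l,
    minor2 (translate g iota1 x) (translate h iota2 x) k l != 0.
  move=> Cx; have [k [l]] := P4n x Cx; rewrite -!scalemxAr minor2_scale => kl.
  by exists k, l; apply: contraNneq kl => ->; rewrite mulr0.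
have indepC x : C x -> exists k l,
    minor2 (translate h iota2 x) (translate g iota1 x) k l != 0.
  by move=> /indep[k [l kl]]; exists k, l; rewrite minor2C oppr_eq0.
have fr1 : row_free g by rewrite row_free_unit.
have fr2 : row_free h by rewrite row_free_unit.
have rg1 := regular_mul fr1 r1; have rg2 := regular_mul fr2 r2.
have repg1 := represents_scale a0 (represents_mul (a *: g) rep1).
have repg2 := represents_scale b0 (represents_mul (b *: h) rep2).
have inj (A : 'M[K]_4) (u : 'rV[K]_4) : A \in unitmx -> u != 0 -> u *m A != 0.
  by move=> uA; apply: contraNneq => uA0; rewrite -(mulmxK uA u) uA0 mul0mx.
have uag : a *: g \in unitmx by rewrite unitmxZ ?unitfE.
have ubh : b *: h \in unitmx by rewrite unitmxZ ?unitfE.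
have scaled (A : 'M[K]_4) (c : K) (u : 'rV[K]_4) : c != 0 -> (u *m (c *: A) == u *m A)%MS.
  by move=> c0; rewrite -scalemxAr; exact: scale_same_point.
have line1 : forall y, pimage C iota1 y -> (y <= col_mx p1 w1)%MS.
  apply: (skew_scroll_line (G := a *: g) uncK cC irC Cs par rg1 rg2 repg1 repg2 _ _ _
    sk indep (fun x _ => scaled g a (iota1 x) a0));
    rewrite ?poly_map_mul ?dif_map_mul //; exact: inj.
have line2 : forall y, pimage C iota2 y -> (y <= col_mx p2 w2)%MS.
  apply: (skew_scroll_line (G := b *: h) uncK cC irC Cs par rg2 rg1 repg2 repg1 _ _ _
    (skew_scrollC sk) indepC (fun x _ => scaled h b (iota2 x) b0));
    rewrite ?poly_map_mul ?dif_map_mul //; [exact: inj|exact: inj|exact: det_frame_swap].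
have {}line1 x : C x -> (iota1 x <= col_mx p1 w1)%MS.
  by move=> Cx; apply: line1; exact: emb1.2.1.2.
have {}line2 x : C x -> (iota2 x <= col_mx p2 w2)%MS.
  by move=> Cx; apply: line2; exact: emb2.2.1.2.
have onto1 := embedding_onto_line cC irC chC emb1 pw1 line1.
have onto2 := embedding_onto_line cC irC chC emb2 pw2 line2.
split; first exact: isomorphic_line emb1 pw1 line1 onto1.
split; first exact: translated_line_degree ug pw1 line1 onto1 deg1.
exact: translated_line_degree uh pw2 line2 onto2 deg2.
Qed.

End Scrolls.

Theorem theorem3p13 (R : realType) (n : nat) (C : pset R[i] n)
    (iota1 iota2 : 'rV[R[i]]_n.+1 -> 'rV[R[i]]_4) :
  smooth_curve C -> embedding C iota1 -> embedding C iota2 ->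
  generically (fun g1 g2 : 'M[R[i]]_4 =>
    forall (d1 d2 : nat) (S : pset R[i] 3),
      scroll C (translate g1 iota1) (translate g2 iota2) d1 d2 S ->
      skew_scroll C (translate g1 iota1) (translate g2 iota2) ->
      isomorphic C (pspace R[i] 1) /\ d1 = 1%N /\ d2 = 1%N).
Proof. exact: (skew_generic_scroll (@uncountable_complex R)). Qed.
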